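(* Let $k$ be a commutative associative unital ring and let $*:U\times V\to W$ be a fully nondegenerate $k$-bimap. There are exact sequences of groups: $$\text{(A)}\quad 1\to \mathcal{L}_*^{\times}\to \mathrm{Aut}( * )\to \mathrm{Aut}(V),$$ $$\text{(B)}\quad 1\to \mathcal{M}_*^{\times}\to \mathrm{Aut}( * )\to \mathrm{Aut}(W),$$ $$\text{(C)}\quad 1\to \mathcal{R}_*^{\times}\to \mathrm{Aut}( * )\to \mathrm{Aut}(U),$$ $$\text{(D)}\quad 1\to \mathrm{Aut}_{\mathcal{C}_*}( * )\to \mathrm{Aut}( * )\to \mathrm{Out}(\mathcal{C}_* ),$$ $$\text{(E)}\quad 1\to Z(\mathcal{LMR}_* )^{\times}\to \mathcal{LMR}_*^{\times}\times \mathrm{Aut}_{\mathcal{LMR}}( * )\to \mathrm{Aut}_{\mathcal{C}_*}( * )\to \mathrm{Out}_{\mathcal{C}_*}(\mathcal{LMR}_* ).$$ Moreover, (F): if $e\in\mathcal{LMR}_*$ satisfies $e^2=e$ and $\mathcal{LMR}_*=(\mathcal{LMR}_* )e(\mathcal{LMR}_* )$, then $$\mathrm{Aut}_{\mathcal{LMR}}( *:U\times V\to W)\cong \mathrm{Aut}_{e\mathcal{LMR}e}(eUe\times eVe\to eWe),$$ where $eUe\times eVe\to eWe$ is the restriction of $*$.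
   Context: All $k$-modules are unital. A $k$-bimap $*:U\times V\to W$ is a biadditive map of $k$-modules with $(su)*v=s(u*v)=u*(sv)$ for $s\in k$. It is fully nondegenerate if $u*V=0\Rightarrow u=0$; $U*v=0\Rightarrow v=0$; and $W$ is additively generated by the products $u*v$. $\mathrm{Aut}( * )$ is the group of autotopisms: triples $\phi$ of $k$-linear automorphisms of $U$, $V$, $W$ (all written $x\mapsto x\phi$, composed left to right) with $u\phi*v\phi=(u*v)\phi$ for all $u,v$. $\mathrm{Aut}(U)$, $\mathrm{Aut}(V)$, $\mathrm{Aut}(W)$ are the $k$-linear automorphism groups. Scalar rings (associative, unital, componentwise operations): $\mathcal{L}_*$ is the ring of pairs $\lambda$ of $k$-endomorphisms of $U$ and of $W$, both written on the left, with $(\lambda u)*v=\lambda(u*v)$ for all $u,v$; $\mathcal{M}_*$ is the ring of pairs $\mu$ consisting of a $k$-endomorphism $u\mapsto u\mu$ of $U$ and a $k$-endomorphism $v\mapsto \mu v$ of $V$ with $(u\mu)*v=u*(\mu v)$, where $u(\mu\mu')=(u\mu)\mu'$ and $(\mu\mu')v=\mu(\mu'v)$; $\mathcal{R}_*$ is the ring of pairs $\rho$ of $k$-endomorphisms of $V$ and of $W$, both written on the right, with $u*(v\rho)=(u*v)\rho$. $\mathcal{LMR}_*=\mathcal{L}_*\oplus\mathcal{M}_*\oplus\mathcal{R}_*$, with center $Z(\mathcal{LMR}_* )$. The centroid $\mathcal{C}_*$ is the ring of triples $\sigma$ of additive endomorphisms of $U,V,W$ with $(u\sigma)*v=(u*v)\sigma=u*(v\sigma)$;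 it is commutative here and embeds in each of $\mathcal{L}_*,\mathcal{M}_*,\mathcal{R}_*$, and embeds diagonally in $\mathcal{LMR}_*$. $A^\times$ is the unit group of a ring $A$. $\mathrm{Aut}_{\mathcal{C}_*}( * )$ is the subgroup of autotopisms commuting with the action of $\mathcal{C}_*$ on $U,V,W$. $\mathrm{Aut}_{\mathcal{LMR}}( * )$ is the subgroup of autotopisms commuting with the actions of $\mathcal{L}_*$ (on $U,W$), $\mathcal{M}_*$ (on $U,V$), $\mathcal{R}_*$ (on $V,W$). $\mathrm{Out}(A)=\mathrm{Aut}(A)/\mathrm{Inn}(A)$ for ring automorphisms, and $\mathrm{Out}_{\mathcal{C}_*}(A)$ is the analogous quotient for $\mathcal{C}_*$-linear ring automorphisms. Maps: $(\lambda,\mu,\rho)\in\mathcal{LMR}_*^\times$ acts as the autotopism $u\mapsto\lambda^{-1}u\mu$, $v\mapsto\mu^{-1}v\rho$, $w\mapsto\lambda^{-1}w\rho$; the left-hand maps in (A)–(C) are its restrictions to the three factors, and the right-hand maps in (A)–(C) are restriction of an autotopism to $V$, $W$, $U$. The maps to $\mathrm{Out}(\mathcal{C}_* )$ and $\mathrm{Out}_{\mathcal{C}_*}(\mathcal{LMR}_* )$ are induced by conjugation by autotopisms. In (E) the middle map sends $((\lambda,\mu,\rho),\alpha)$ to the autotopism of $(\lambda,\mu,\rho)$ composed with $\alpha^{-1}$. For an idempotent $e=(e_1,e_2,e_3)\in\mathcal{L}_*\oplus\mathcal{M}_*\oplus\mathcal{R}_*$: $eUe=e_1Ue_2$, $eVe=e_2Ve_3$,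 $eWe=e_1We_3$, and $e\mathcal{LMR}e=e_1\mathcal{L}_*e_1\oplus e_2\mathcal{M}_*e_2\oplus e_3\mathcal{R}_*e_3$, acting on these; $\mathrm{Aut}_{e\mathcal{LMR}e}$ denotes autotopisms commuting with these actions.
   Formalization: In (E), the factor Aut_LMR( * ) carries the opposite multiplication, because the stated middle map, composing with α⁻¹, is not a homomorphism on the plain direct product when Aut_LMR( * ) is non-abelian (e.g. V×V→Λ²V, dim V≥3). *)

(* Defs.v *)
From HB Require Import structures.
From mathcomp Require Import all_boot all_order all_algebra.
From mathcomp Require Import boolp.

Set Implicit Arguments.
Unset Strict Implicit.
Unset Printing Implicit Defensive.

Import GRing.Theory.
Local Open Scope ring_scope.

Lemma linear_ext (k : pzRingType) (U V : lmodType k) (f g : {linear U -> V}) :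
  f =1 g -> f = g.
Proof.
move=> /funext; case: f g => f [[f1] [f2]] [g [[g1] [g2]]] /= fg.
case: _ / fg in g1 g2 *.
by rewrite (Prop_irrelevance f1 g1) (Prop_irrelevance f2 g2).
Qed.

Lemma additive_ext (U V : zmodType) (f g : {additive U -> V}) :
  f =1 g -> f = g.
Proof.
move=> /funext; case: f g => f [[f1]] [g [[g1]]] /= fg.
by case: _ / fg in g1 *; rewrite (Prop_irrelevance f1 g1).
Qed.

Lemma rmorphism_ext (A B : pzRingType) (f g : {rmorphism A -> B}) :
  f =1 g -> f = g.
Proof.
move=> /funext; case: f g => f [[f1] [f2]] [g [[g1] [g2]]] /= fg.
case: _ / fg in g1 g2 *.
by rewrite (Prop_irrelevance f1 g1) (Prop_irrelevance f2 g2).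
Qed.

(* The product of addEnd U and of linEnd U is f \o g, that is, endomorphisms are
   written on the left; endomorphisms written on the right form the converse
   rings (addEnd U)^c and (linEnd U)^c. *)
Definition addEnd (U : zmodType) : Type := {additive U -> U}.

Section AddEnd.
Variable U : zmodType.
HB.instance Definition _ := gen_eqMixin (addEnd U).
HB.instance Definition _ := gen_choiceMixin (addEnd U).

Implicit Types f g h : addEnd U.
Definition addEnd_zero : addEnd U := \0 : {additive U -> U}.
Definition addEnd_add f g : addEnd U := (f \+ g : {additive U -> U}).
Definition addEnd_opp f : addEnd U := (\- f : {additive U -> U}).
Definition addEnd_one : addEnd U := idfun : {additive U -> U}.
Definition addEnd_mul f g : addEnd U := (f \o g : {additive U -> U}).

Fact addEnd_addA : associative addEnd_add.
Proof. by move=> f g h; apply: additive_ext => u /=; rewrite addrA. Qed.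
Fact addEnd_addC : commutative addEnd_add.
Proof. by move=> f g; apply: additive_ext => u /=; rewrite addrC. Qed.
Fact addEnd_add0 : left_id addEnd_zero addEnd_add.
Proof. by move=> f; apply: additive_ext => u /=; rewrite add0r. Qed.
Fact addEnd_addN : left_inverse addEnd_zero addEnd_opp addEnd_add.
Proof. by move=> f; apply: additive_ext => u /=; rewrite addNr. Qed.
HB.instance Definition _ := GRing.isZmodule.Build (addEnd U)
  addEnd_addA addEnd_addC addEnd_add0 addEnd_addN.

Fact addEnd_mulA : associative addEnd_mul.
Proof. by move=> f g h; apply: additive_ext. Qed.
Fact addEnd_mul1l : left_id addEnd_one addEnd_mul.
Proof. by move=> f; apply: additive_ext. Qed.
Fact addEnd_mul1r : right_id addEnd_one addEnd_mul.
Proof. by move=> f; apply: additive_ext. Qed.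
Fact addEnd_mulDl : left_distributive addEnd_mul addEnd_add.
Proof. by move=> f g h; apply: additive_ext. Qed.
Fact addEnd_mulDr : right_distributive addEnd_mul addEnd_add.
Proof. by move=> f g h; apply: additive_ext => u /=; rewrite raddfD. Qed.
HB.instance Definition _ := GRing.Zmodule_isPzRing.Build (addEnd U)
  addEnd_mulA addEnd_mul1l addEnd_mul1r addEnd_mulDl addEnd_mulDr.
End AddEnd.

Definition linEnd (k : pzRingType) (U : lmodType k) : Type := {linear U -> U}.

Section LinEnd.
Variables (k : comPzRingType) (U : lmodType k).
HB.instance Definition _ := gen_eqMixin (linEnd U).
HB.instance Definition _ := gen_choiceMixin (linEnd U).

Implicit Types f g h : linEnd U.
Definition linEnd_zero : linEnd U := \0 : {linear U -> U}.
Definition linEnd_add f g : linEnd U := (f \+ g : {linear U -> U}).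
Definition linEnd_opp f : linEnd U := (\- f : {linear U -> U}).
Definition linEnd_one : linEnd U := idfun : {linear U -> U}.
Definition linEnd_mul f g : linEnd U := (f \o g : {linear U -> U}).

Fact linEnd_addA : associative linEnd_add.
Proof. by move=> f g h; apply: linear_ext => u /=; rewrite addrA. Qed.
Fact linEnd_addC : commutative linEnd_add.
Proof. by move=> f g; apply: linear_ext => u /=; rewrite addrC. Qed.
Fact linEnd_add0 : left_id linEnd_zero linEnd_add.
Proof. by move=> f; apply: linear_ext => u /=; rewrite add0r. Qed.
Fact linEnd_addN : left_inverse linEnd_zero linEnd_opp linEnd_add.
Proof. by move=> f; apply: linear_ext => u /=; rewrite addNr. Qed.
HB.instance Definition _ := GRing.isZmodule.Build (linEnd U)
  linEnd_addA linEnd_addC linEnd_add0 linEnd_addN.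

Fact linEnd_mulA : associative linEnd_mul.
Proof. by move=> f g h; apply: linear_ext. Qed.
Fact linEnd_mul1l : left_id linEnd_one linEnd_mul.
Proof. by move=> f; apply: linear_ext. Qed.
Fact linEnd_mul1r : right_id linEnd_one linEnd_mul.
Proof. by move=> f; apply: linear_ext. Qed.
Fact linEnd_mulDl : left_distributive linEnd_mul linEnd_add.
Proof. by move=> f g h; apply: linear_ext. Qed.
Fact linEnd_mulDr : right_distributive linEnd_mul linEnd_add.
Proof. by move=> f g h; apply: linear_ext => u /=; rewrite raddfD. Qed.
HB.instance Definition _ := GRing.Zmodule_isPzRing.Build (linEnd U)
  linEnd_mulA linEnd_mul1l linEnd_mul1r linEnd_mulDl linEnd_mulDr.
End LinEnd.

(* A unit of M is stored together with its (unique) two-sided inverse. *)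
Record units (M : monoidType) := MkUnit {
  unit_pair : M * M;
  _ : ((unit_pair.1 * unit_pair.2 == 1) && (unit_pair.2 * unit_pair.1 == 1))%g
}.
HB.instance Definition _ (M : monoidType) := [isSub for @unit_pair M].
HB.instance Definition _ (M : monoidType) := [Choice of units M by <:].

Section Units.
Variable M : monoidType.
Implicit Types x y z : units M.

Definition uval x : M := (unit_pair x).1.
Definition uinv x : M := (unit_pair x).2.

Lemma uvalK x : (uval x * uinv x = 1)%g.
Proof. by have /andP[/eqP] := valP x. Qed.
Lemma uinvK x : (uinv x * uval x = 1)%g.
Proof. by have /andP[_ /eqP] := valP x. Qed.

Definition mk_unit (a b : M) (ab : (a * b = 1)%g) (ba : (b * a = 1)%g) :
    units M := @MkUnit M (a, b) (introT andP (conj (introT eqP ab) (introT eqP ba))).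

Lemma unit_ext x y : uval x = uval y -> x = y.
Proof.
move=> xy; have xy' : uinv x = uinv y.
  by rewrite -[LHS]mulg1 -(uvalK y) -xy mulgA uinvK mul1g.
apply: val_inj; move: xy xy'; rewrite /uval /uinv /=.
by case: (unit_pair x) (unit_pair y) => a b [c d] /= -> ->.
Qed.

Definition unit_one : units M := mk_unit (mul1g 1%g) (mul1g 1%g).

Fact unit_mul_subproof x y :
  ((uval x * uval y) * (uinv y * uinv x) = 1)%g.
Proof. by rewrite -mulgA (mulgA (uval y)) uvalK mul1g uvalK. Qed.
Fact unit_mul_subproof' x y :
  ((uinv y * uinv x) * (uval x * uval y) = 1)%g.
Proof. by rewrite -mulgA (mulgA (uinv x)) uinvK mul1g uinvK. Qed.
Definition unit_mul x y : units M :=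
  mk_unit (unit_mul_subproof x y) (unit_mul_subproof' x y).
Definition unit_inv x : units M := mk_unit (uinvK x) (uvalK x).

Fact unit_mulA : associative unit_mul.
Proof. by move=> x y z; apply: unit_ext; rewrite /uval /= mulgA. Qed.
Fact unit_mul1l : left_id unit_one unit_mul.
Proof. by move=> x; apply: unit_ext; rewrite /uval /= mul1g. Qed.
Fact unit_mul1r : right_id unit_one unit_mul.
Proof. by move=> x; apply: unit_ext; rewrite /uval /= mulg1. Qed.
Fact unit_mulV : left_inverse unit_one unit_inv unit_mul.
Proof. by move=> x; apply: unit_ext; apply: uinvK. Qed.
Fact unit_mulV' : right_inverse unit_one unit_inv unit_mul.
Proof. by move=> x; apply: unit_ext; apply: uvalK. Qed.
HB.instance Definition _ := isGroup.Build (units M)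
  unit_mulA unit_mul1l unit_mul1r unit_mulV unit_mulV'.
End Units.

Definition mulMonoid (A : pzRingType) : Type := A.
HB.instance Definition _ (A : pzRingType) := Choice.on (mulMonoid A).
HB.instance Definition _ (A : pzRingType) := isMonoid.Build (mulMonoid A)
  (@mulrA A) (@mul1r A) (@mulr1 A).

Notation ringUnits A := (units (mulMonoid A)).
Definition rval (A : pzRingType) (x : ringUnits A) : A := uval x.
Definition rinv (A : pzRingType) (x : ringUnits A) : A := uinv x.

(* Invertible linear maps, composed from left to right. *)
Notation linAut U := (units (mulMonoid (linEnd U)^c)).
Definition laut (k : comPzRingType) (U : lmodType k) (f : linAut U) : U -> U :=
  (uval f : linEnd U).
HB.instance Definition _ (k : comPzRingType) (U : lmodType k) (f : linAut U) :=
  GRing.Linear.copy (laut f) (uval f : linEnd U).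

(* Ring endomorphisms and automorphisms, composed from left to right. *)
Definition ringEnd (A : pzRingType) : Type := {rmorphism A -> A}.
Section RingEnd.
Variable A : pzRingType.
HB.instance Definition _ := gen_eqMixin (ringEnd A).
HB.instance Definition _ := gen_choiceMixin (ringEnd A).
Definition ringEnd_one : ringEnd A := idfun : {rmorphism A -> A}.
Definition ringEnd_mul (f g : ringEnd A) : ringEnd A :=
  (g \o f : {rmorphism A -> A}).
Fact ringEnd_mulA : associative ringEnd_mul.
Proof. by move=> f g h; apply: rmorphism_ext. Qed.
Fact ringEnd_mul1l : left_id ringEnd_one ringEnd_mul.
Proof. by move=> f; apply: rmorphism_ext. Qed.
Fact ringEnd_mul1r : right_id ringEnd_one ringEnd_mul.
Proof. by move=> f; apply: rmorphism_ext. Qed.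
HB.instance Definition _ := isMonoid.Build (ringEnd A)
  ringEnd_mulA ringEnd_mul1l ringEnd_mul1r.
End RingEnd.

Notation ringAut A := (units (ringEnd A)).
Definition raut (A : pzRingType) (f : ringAut A) : A -> A := (uval f : ringEnd A).
HB.instance Definition _ (A : pzRingType) (f : ringAut A) :=
  GRing.RMorphism.copy (raut f) (uval f : ringEnd A).

Record subgrp (G : groupType) (S : groupClosed G) := SubGrp {
  sgval : G;
  _ : sgval \in S
}.
HB.instance Definition _ (G : groupType) (S : groupClosed G) :=
  [isSub for @sgval G S].
HB.instance Definition _ (G : groupType) (S : groupClosed G) :=
  [Choice of subgrp S by <:].
Fact subgrp_closed (G : groupType) (S : groupClosed G) : group_closed S.
Proof. by split; [apply: gpred1 | apply: gpredF]. Qed.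
HB.instance Definition _ (G : groupType) (S : groupClosed G) :=
  SubChoice_isSubGroup.Build G (S : {pred G}) (subgrp S) (subgrp_closed S).

Record submod (k : pzRingType) (U : lmodType k) (S : submodClosed U) := SubMod {
  smval : U;
  _ : smval \in S
}.
HB.instance Definition _ (k : pzRingType) (U : lmodType k)
  (S : submodClosed U) := [isSub for @smval k U S].
HB.instance Definition _ (k : pzRingType) (U : lmodType k)
  (S : submodClosed U) := [Choice of submod S by <:].
HB.instance Definition _ (k : pzRingType) (U : lmodType k)
  (S : submodClosed U) := [SubChoice_isSubLmodule of submod S by <:].

Record subring (A : pzRingType) (S : subringClosed A) := SubRing {
  srval : A;
  _ : srval \in S
}.
HB.instance Definition _ (A : pzRingType) (S : subringClosed A) :=
  [isSub for @srval A S].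
HB.instance Definition _ (A : pzRingType) (S : subringClosed A) :=
  [Choice of subring S by <:].
HB.instance Definition _ (A : pzRingType) (S : subringClosed A) :=
  GRing.SubChoice_isSubPzRing.Build A (S : {pred A}) (subring S)
    (subringClosedP S).

Definition opGroup (G : groupType) : Type := G.
HB.instance Definition _ (G : groupType) := Choice.on (opGroup G).
Section OpGroup.
Variable G : groupType.
Fact opGroup_mulA : associative (fun x y : G => (y * x)%g).
Proof. by move=> x y z; rewrite mulgA. Qed.
HB.instance Definition _ := isGroup.Build (opGroup G)
  opGroup_mulA (@mulg1 G) (@mul1g G) (@mulgV G) (@mulVg G).
End OpGroup.

Record normalSubgroup (G : groupType) := NormalSubgroup {
  nsub :> {pred G};
  nsub_group : group_closed nsub;
  nsub_normal : forall x y, y \in nsub -> (y ^ x)%g \in nsub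
}.

Section QuotientGroup.
Local Open Scope quotient_scope.
Variables (G : groupType) (N : normalSubgroup G).

Definition nsub_equiv (x y : G) := (x * y^-1)%g \in N.

Fact nsubM x y : x \in N -> y \in N -> (x * y)%g \in N.
Proof. exact: (group_closedM (nsub_group N)). Qed.
Fact nsubV x : x \in N -> (x^-1)%g \in N.
Proof. exact: (group_closedV (nsub_group N)). Qed.

Fact nsub_equiv_is_equiv : equiv_class_of nsub_equiv.
Proof.
rewrite /nsub_equiv; split=> [x|x y|y x z].
- by rewrite mulgV; case: (nsub_group N).
- by apply/idP/idP=> /nsubV; rewrite invgM invgK.
- by move=> xy yz; have := nsubM xy yz; rewrite mulgA mulgVK.
Qed.
Canonical nsub_equiv_rel := EquivRelPack nsub_equiv_is_equiv.

Definition quotGroup := {eq_quot nsub_equiv}.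
HB.instance Definition _ := Choice.on quotGroup.
HB.instance Definition _ := EqQuotient.on quotGroup.

Definition quot_pi (x : G) : quotGroup := \pi_quotGroup x.
Definition quot_mul (x y : quotGroup) := quot_pi (repr x * repr y)%g.
Definition quot_inv (x : quotGroup) := quot_pi (repr x)^-1%g.

Lemma quot_piP x y : quot_pi x = quot_pi y <-> (x * y^-1)%g \in N.
Proof. by split=> [/eqmodP|xy]; [|apply/eqmodP]. Qed.

Lemma quot_reprK x : quot_pi (repr x) = x.
Proof. exact: reprK. Qed.

Lemma quot_piM x y : quot_mul (quot_pi x) (quot_pi y) = quot_pi (x * y)%g.
Proof.
apply/quot_piP; set x' := repr _; set y' := repr _.
have Nx : (x' * x^-1)%g \in N by apply/quot_piP; rewrite quot_reprK.
have Ny : (y' * y^-1)%g \in N by apply/quot_piP; rewrite quot_reprK.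
have -> : (x' * y' * (x * y)^-1 = (x' * x^-1) * (y' * y^-1) ^ x^-1)%g.
  by rewrite /conjg invgM invgK !mulgA mulgVK.
by apply: nsubM => //; apply: nsub_normal.
Qed.

Lemma quot_piV x : quot_inv (quot_pi x) = quot_pi x^-1%g.
Proof.
apply/quot_piP; set x' := repr _.
have Nx : (x' * x^-1)%g \in N by apply/quot_piP; rewrite quot_reprK.
rewrite invgK; have := nsub_normal x (nsubV Nx).
by rewrite /conjg invgM invgK mulgA mulgA mulVg mul1g.
Qed.

Fact quot_mulA : associative quot_mul.
Proof.
move=> x y z; rewrite -[x]quot_reprK -[y]quot_reprK -[z]quot_reprK.
by rewrite !quot_piM mulgA.
Qed.
Fact quot_mul1l : left_id (quot_pi 1%g) quot_mul.
Proof. by move=> x; rewrite -[x]quot_reprK quot_piM mul1g. Qed.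
Fact quot_mul1r : right_id (quot_pi 1%g) quot_mul.
Proof. by move=> x; rewrite -[x]quot_reprK quot_piM mulg1. Qed.
Fact quot_mulV : left_inverse (quot_pi 1%g) quot_inv quot_mul.
Proof. by move=> x; rewrite -[x]quot_reprK quot_piV quot_piM mulVg. Qed.
Fact quot_mulV' : right_inverse (quot_pi 1%g) quot_inv quot_mul.
Proof. by move=> x; rewrite -[x]quot_reprK quot_piV quot_piM mulgV. Qed.
HB.instance Definition _ := isGroup.Build quotGroup
  quot_mulA quot_mul1l quot_mul1r quot_mulV quot_mulV'.
End QuotientGroup.

Section Out.
Variable A : pzRingType.

Definition inner : {pred ringAut A} := fun f =>
  `[< exists x : ringUnits A, forall a, raut f a = rinv x * a * rval x >].

Lemma rvalK (x : ringUnits A) : rval x * rinv x = 1.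
Proof. exact: (@uvalK (mulMonoid A) x). Qed.
Lemma rinvK (x : ringUnits A) : rinv x * rval x = 1.
Proof. exact: (@uinvK (mulMonoid A) x). Qed.
Lemma rautK (f : ringAut A) a : raut f^-1%g (raut f a) = a.
Proof. by have /(congr1 (fun g : ringEnd A => g a)) := uvalK f. Qed.

Fact inner_group : group_closed inner.
Proof.
split; first by apply/asboolP; exists 1%g => a; rewrite /rinv /rval /= mul1r mulr1.
move=> f g /asboolP[x fx] /asboolP[y gy]; apply/asboolP; exists (x * y^-1)%g => a.
change (raut g^-1%g (raut f a) = (rval y * rinv x) * a * (rval x * rinv y)).
rewrite -[RHS](rautK g) gy fx; congr (raut _ _).
rewrite !mulrA rinvK mul1r -[LHS]mulr1 -(rinvK y); rewrite -!mulrA.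
by rewrite rinvK mulr1.
Qed.

Fact inner_normal f g : g \in inner -> (g ^ f)%g \in inner.
Proof.
move=> /asboolP[x gx]; apply/asboolP.
have xx : raut f (rval x) * raut f (rinv x) = 1.
  by rewrite -rmorphM rvalK rmorph1.
have xx' : raut f (rinv x) * raut f (rval x) = 1.
  by rewrite -rmorphM rinvK rmorph1.
exists (@mk_unit (mulMonoid A) _ _ xx xx') => a.
change (raut f (raut g (raut f^-1%g a)) = raut f (rinv x) * a * raut f (rval x)).
rewrite gx !rmorphM; congr (_ * _ * _).
by have := rautK f^-1%g a; rewrite invgK.
Qed.

Definition Inn : normalSubgroup (ringAut A) :=
  NormalSubgroup inner_group inner_normal.
Definition Out := quotGroup Inn.

Variables (C : pzRingType) (iota : C -> A).

(* Automorphisms that are linear for the action c . a = iota c * a. *)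
Definition Clinear : {pred ringAut A} := fun f =>
  `[< forall c a, raut f (iota c * a) = iota c * raut f a >].

Fact Clinear1 : 1%g \in Clinear.
Proof. exact/asboolP. Qed.
Fact ClinearM : mulg_closed Clinear.
Proof.
move=> f g /asboolP fC /asboolP gC; apply/asboolP=> c a.
by change (raut g (raut f (iota c * a)) = iota c * raut g (raut f a)); rewrite fC gC.
Qed.
Fact ClinearV : invg_closed Clinear.
Proof.
move=> f /asboolP fC; apply/asboolP=> c a.
rewrite -[RHS](rautK f) fC; congr (raut _ (_ * _)).
by have := rautK f^-1%g a; rewrite invgK.
Qed.
HB.instance Definition _ := isMulClosed.Build (ringAut A) Clinear ClinearM.
HB.instance Definition _ := isMul1Closed.Build (ringAut A) Clinear Clinear1.
HB.instance Definition _ := isInvClosed.Build (ringAut A) Clinear ClinearV.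

Definition ClinAut := @subgrp (ringAut A) Clinear.

(* When iota has central image, as for centroid_to_LMR below, every inner
   automorphism is linear, so that this is all of Inn(A). *)
Definition Cinner : {pred ClinAut} := fun f => sgval f \in inner.
Fact Cinner_group : group_closed Cinner.
Proof.
by split; [case: inner_group | move=> f g; apply: inner_group.2].
Qed.
Fact Cinner_normal f g : g \in Cinner -> (g ^ f)%g \in Cinner.
Proof. exact: inner_normal. Qed.
Definition CInn : normalSubgroup ClinAut :=
  NormalSubgroup Cinner_group Cinner_normal.
Definition COut := quotGroup CInn.
End Out.

Section Center.
Variable A : pzRingType.
Definition central : {pred A} := fun z => `[< forall a, z * a = a * z >].
Fact central_closed : subring_closed central.
Proof.
split=> [|x y /asboolP xC /asboolP yC|x y /asboolP xC /asboolP yC];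
  apply/asboolP=> a.
- by rewrite mul1r mulr1.
- by rewrite mulrBl mulrBr xC yC.
- by rewrite mulrA -xC -!mulrA yC.
Qed.
HB.instance Definition _ := GRing.isSubringClosed.Build A central central_closed.
Definition center := subring central.
End Center.

(* A record rather than {bilinear U -> V -> W}, which requires 1 != 0 in k. *)
Record bimap (k : comPzRingType) (U V W : lmodType k) := Bimap {
  bmul :> U -> V -> W;
  bmulDl : forall u u' v, bmul (u + u') v = bmul u v + bmul u' v;
  bmulDr : forall u v v', bmul u (v + v') = bmul u v + bmul u v';
  bmulZl : forall s u v, bmul (s *: u) v = s *: bmul u v;
  bmulZr : forall s u v, bmul u (s *: v) = s *: bmul u v
}.

Definition fully_nondegenerate (k : comPzRingType) (U V W : lmodType k)
    (b : bimap U V W) : Prop :=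
  [/\ forall u, (forall v, b u v = 0) -> u = 0,
      forall v, (forall u, b u v = 0) -> v = 0
    & forall w, exists s : seq (U * V), w = \sum_(p <- s) b p.1 p.2].

Section EndLemmas.
Lemma srvalM (A : pzRingType) (S : subringClosed A) (x y : subring S) :
  srval (x * y) = srval x * srval y.
Proof. by []. Qed.
Lemma srvalB (A : pzRingType) (S : subringClosed A) (x y : subring S) :
  srval (x - y) = srval x - srval y.
Proof. by []. Qed.
Lemma fstB (A B : zmodType) (x y : A * B) : (x - y).1 = x.1 - y.1.
Proof. by []. Qed.
Lemma sndB (A B : zmodType) (x y : A * B) : (x - y).2 = x.2 - y.2.
Proof. by []. Qed.
Lemma addEndcB (X : zmodType) (f g : (addEnd X)^c) x :
  ((f - g : (addEnd X)^c) : addEnd X) x = (f : addEnd X) x - (g : addEnd X) x.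
Proof. by []. Qed.
Lemma addEndcM (X : zmodType) (f g : (addEnd X)^c) x :
  ((f * g : (addEnd X)^c) : addEnd X) x = (g : addEnd X) ((f : addEnd X) x).
Proof. by []. Qed.
Lemma fstM (A B : pzRingType) (x y : A * B) : (x * y).1 = x.1 * y.1.
Proof. by []. Qed.
Lemma sndM (A B : pzRingType) (x y : A * B) : (x * y).2 = x.2 * y.2.
Proof. by []. Qed.
Variables (k : comPzRingType) (U : lmodType k).
Lemma linEndM (f g : linEnd U) u : (f * g) u = f (g u).
Proof. by []. Qed.
Lemma linEndcM (f g : (linEnd U)^c) u :
  ((f * g : (linEnd U)^c) : linEnd U) u = (g : linEnd U) ((f : linEnd U) u).
Proof. by []. Qed.
Lemma uvalM (M : monoidType) (f g : units M) :
  uval (f * g)%g = (uval f * uval g)%g.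
Proof. by []. Qed.
Lemma mulMonoidM (A : pzRingType) (x y : A) :
  (x * y)%R = ((x : mulMonoid A) * (y : mulMonoid A))%g.
Proof. by []. Qed.
Lemma gfstM (G H : groupType) (x y : G * H) : (x * y).1%g = (x.1 * y.1)%g.
Proof. by []. Qed.
Lemma gsndM (G H : groupType) (x y : G * H) : (x * y).2%g = (x.2 * y.2)%g.
Proof. by []. Qed.
Lemma gfstV (G H : groupType) (x : G * H) : (x^-1).1%g = (x.1^-1)%g.
Proof. by []. Qed.
Lemma gsndV (G H : groupType) (x : G * H) : (x^-1).2%g = (x.2^-1)%g.
Proof. by []. Qed.
End EndLemmas.

Section Bimap.
Variables (k : comPzRingType) (U V W : lmodType k) (b : bimap U V W).

Lemma bmul0l v : b 0 v = 0.
Proof. by rewrite -(scale0r 0) bmulZl scale0r. Qed.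
Lemma bmul0r u : b u 0 = 0.
Proof. by rewrite -(scale0r 0) bmulZr scale0r. Qed.
Lemma bmulBl u u' v : b (u - u') v = b u v - b u' v.
Proof. by rewrite bmulDl -[- u']scaleN1r bmulZl scaleN1r. Qed.
Lemma bmulBr u v v' : b u (v - v') = b u v - b u v'.
Proof. by rewrite bmulDr -[- v']scaleN1r bmulZr scaleN1r. Qed.

(* Elements of L are written on the left, those of R on the right, and those of
   M on the right of U and on the left of V. *)
Definition is_Lscalar : {pred linEnd U * linEnd W} := fun p =>
  `[< forall u v, b (p.1 u) v = p.2 (b u v) >].

Definition is_Mscalar : {pred (linEnd U)^c * linEnd V} := fun p =>
  `[< forall u v, b ((p.1 : linEnd U) u) v = b u (p.2 v) >].

Definition is_Rscalar : {pred (linEnd V)^c * (linEnd W)^c} := fun p =>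
  `[< forall u v, b u ((p.1 : linEnd V) v) = (p.2 : linEnd W) (b u v) >].

(* The centroid consists of triples of additive maps; k-linearity is not
   required. *)
Definition is_Cscalar :
    {pred (addEnd U)^c * (addEnd V)^c * (addEnd W)^c} := fun p =>
  `[< forall u v,
        b ((p.1.1 : addEnd U) u) v = (p.2 : addEnd W) (b u v) /\
        (p.2 : addEnd W) (b u v) = b u ((p.1.2 : addEnd V) v) >].

Fact Lscalar_closed : subring_closed is_Lscalar.
Proof.
split=> [|x y /asboolP xL /asboolP yL|x y /asboolP xL /asboolP yL];
  apply/asboolP=> u v //.
- change (b (x.1 u - y.1 u) v = x.2 (b u v) - y.2 (b u v)).
  by rewrite bmulBl xL yL.
- change (b (x.1 (y.1 u)) v = x.2 (y.2 (b u v))).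
  by rewrite xL yL.
Qed.
HB.instance Definition _ :=
  GRing.isSubringClosed.Build (linEnd U * linEnd W)%type is_Lscalar Lscalar_closed.

Fact Mscalar_closed : subring_closed is_Mscalar.
Proof.
split=> [|x y /asboolP xL /asboolP yL|x y /asboolP xL /asboolP yL];
  apply/asboolP=> u v //.
- change (b ((x.1 : linEnd U) u - (y.1 : linEnd U) u) v = b u (x.2 v - y.2 v)).
  by rewrite bmulBl bmulBr xL yL.
- change (b ((y.1 : linEnd U) ((x.1 : linEnd U) u)) v = b u (x.2 (y.2 v))).
  by rewrite yL xL.
Qed.
HB.instance Definition _ :=
  GRing.isSubringClosed.Build ((linEnd U)^c * linEnd V)%type is_Mscalar Mscalar_closed.

Fact Rscalar_closed : subring_closed is_Rscalar.
Proof.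
split=> [|x y /asboolP xL /asboolP yL|x y /asboolP xL /asboolP yL];
  apply/asboolP=> u v //.
- change (b u ((x.1 : linEnd V) v - (y.1 : linEnd V) v) =
          (x.2 : linEnd W) (b u v) - (y.2 : linEnd W) (b u v)).
  by rewrite bmulBr xL yL.
- change (b u ((y.1 : linEnd V) ((x.1 : linEnd V) v)) =
          (y.2 : linEnd W) ((x.2 : linEnd W) (b u v))).
  by rewrite yL xL.
Qed.
HB.instance Definition _ :=
  GRing.isSubringClosed.Build ((linEnd V)^c * (linEnd W)^c)%type
    is_Rscalar Rscalar_closed.

Fact Cscalar_closed : subring_closed is_Cscalar.
Proof.
split=> [|x y /asboolP xL /asboolP yL|x y /asboolP xL /asboolP yL];
  apply/asboolP=> u v //; have [x1 x2] := xL u v; have [y1 y2] := yL u v.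
- by rewrite !(fstB, sndB) !addEndcB bmulBl bmulBr x1 y1 x2 y2.
- rewrite !(fstM, sndM) !addEndcM; split; first by rewrite (yL _ v).1 x1.
  by rewrite x2 (yL u _).2.
Qed.
HB.instance Definition _ :=
  GRing.isSubringClosed.Build ((addEnd U)^c * (addEnd V)^c * (addEnd W)^c)%type
    is_Cscalar Cscalar_closed.

Definition Lring := subring is_Lscalar.
Definition Mring := subring is_Mscalar.
Definition Rring := subring is_Rscalar.
Definition centroid := subring is_Cscalar.
HB.instance Definition _ := GRing.PzRing.on Lring.
HB.instance Definition _ := GRing.PzRing.on Mring.
HB.instance Definition _ := GRing.PzRing.on Rring.
HB.instance Definition _ := GRing.PzRing.on centroid.
Definition LMR : Type := (Lring * Mring * Rring)%type.
HB.instance Definition _ := GRing.PzRing.on LMR.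

Definition LU (x : Lring) : U -> U := ((srval x).1 : linEnd U).
HB.instance Definition _ x := GRing.Linear.copy (LU x) ((srval x).1 : linEnd U).
Definition LW (x : Lring) : W -> W := ((srval x).2 : linEnd W).
HB.instance Definition _ x := GRing.Linear.copy (LW x) ((srval x).2 : linEnd W).
Definition MU (x : Mring) : U -> U := ((srval x).1 : linEnd U).
HB.instance Definition _ x := GRing.Linear.copy (MU x) ((srval x).1 : linEnd U).
Definition MV (x : Mring) : V -> V := ((srval x).2 : linEnd V).
HB.instance Definition _ x := GRing.Linear.copy (MV x) ((srval x).2 : linEnd V).
Definition RV (x : Rring) : V -> V := ((srval x).1 : linEnd V).
HB.instance Definition _ x := GRing.Linear.copy (RV x) ((srval x).1 : linEnd V).
Definition RW (x : Rring) : W -> W := ((srval x).2 : linEnd W).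
HB.instance Definition _ x := GRing.Linear.copy (RW x) ((srval x).2 : linEnd W).
Definition CU (x : centroid) : U -> U := ((srval x).1.1 : addEnd U).
HB.instance Definition _ x := Algebra.Additive.copy (CU x) ((srval x).1.1 : addEnd U).
Definition CV (x : centroid) : V -> V := ((srval x).1.2 : addEnd V).
HB.instance Definition _ x := Algebra.Additive.copy (CV x) ((srval x).1.2 : addEnd V).
Definition CW (x : centroid) : W -> W := ((srval x).2 : addEnd W).
HB.instance Definition _ x := Algebra.Additive.copy (CW x) ((srval x).2 : addEnd W).

Lemma LUW x u v : b (LU x u) v = LW x (b u v).
Proof. by have /asboolP := valP x; apply. Qed.
Lemma MUV x u v : b (MU x u) v = b u (MV x v).
Proof. by have /asboolP := valP x; apply. Qed.
Lemma RVW x u v : b u (RV x v) = RW x (b u v).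
Proof. by have /asboolP := valP x; apply. Qed.
Lemma CUW x u v : b (CU x u) v = CW x (b u v).
Proof. by have /asboolP/(_ u v)[] := valP x. Qed.
Lemma CVW x u v : b u (CV x v) = CW x (b u v).
Proof. by have /asboolP/(_ u v)[_ ->] := valP x. Qed.

Lemma LU_M x y u : LU (x * y) u = LU x (LU y u). Proof. by []. Qed.
Lemma LW_M x y w : LW (x * y) w = LW x (LW y w). Proof. by []. Qed.
Lemma MU_M x y u : MU (x * y) u = MU y (MU x u).
Proof. by rewrite /MU srvalM fstM linEndcM. Qed.
Lemma MV_M x y v : MV (x * y) v = MV x (MV y v). 
Proof. by rewrite /MV srvalM sndM linEndM. Qed.
Lemma RV_M x y v : RV (x * y) v = RV y (RV x v).
Proof. by rewrite /RV srvalM fstM linEndcM. Qed.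
Lemma RW_M x y w : RW (x * y) w = RW y (RW x w). 
Proof. by rewrite /RW srvalM sndM linEndcM. Qed.

Definition is_autotopism : {pred linAut U * linAut V * linAut W} := fun p =>
  `[< forall u v, b (laut p.1.1 u) (laut p.1.2 v) = laut p.2 (b u v) >].

Lemma lautM (X : lmodType k) (f g : linAut X) x :
  laut (f * g)%g x = laut g (laut f x).
Proof. by rewrite /laut uvalM -mulMonoidM linEndcM. Qed.
Lemma lautK (X : lmodType k) (f : linAut X) : cancel (laut f) (laut f^-1%g).
Proof. by move=> x; have /(congr1 (fun g : linEnd X => g x)) := uvalK f. Qed.
Lemma lautVK (X : lmodType k) (f : linAut X) : cancel (laut f^-1%g) (laut f).
Proof. by move=> x; have /(congr1 (fun g : linEnd X => g x)) := uinvK f. Qed.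

Fact autotopismM : mulg_closed is_autotopism.
Proof.
move=> f g /asboolP fA /asboolP gA; apply/asboolP=> u v.
by rewrite !(gfstM, gsndM) !lautM gA fA.
Qed.
Fact autotopism1 : 1%g \in is_autotopism.
Proof. exact/asboolP. Qed.
Fact autotopismV : invg_closed is_autotopism.
Proof.
move=> f /asboolP fA; apply/asboolP=> u v.
by rewrite !(gfstV, gsndV) -[LHS](lautK f.2) -fA !lautVK.
Qed.
HB.instance Definition _ := isMulClosed.Build (linAut U * linAut V * linAut W)%type
  is_autotopism autotopismM.
HB.instance Definition _ := isMul1Closed.Build (linAut U * linAut V * linAut W)%type
  is_autotopism autotopism1.
HB.instance Definition _ := isInvClosed.Build (linAut U * linAut V * linAut W)%type
  is_autotopism autotopismV.

Definition Autotop := subgrp is_autotopism.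
HB.instance Definition _ := Group.on Autotop.

Definition autU (f : Autotop) : linAut U := (sgval f).1.1.
Definition autV (f : Autotop) : linAut V := (sgval f).1.2.
Definition autW (f : Autotop) : linAut W := (sgval f).2.
Definition actU (f : Autotop) : U -> U := laut (autU f).
HB.instance Definition _ f := GRing.Linear.copy (actU f) (laut (autU f)).
Definition actV (f : Autotop) : V -> V := laut (autV f).
HB.instance Definition _ f := GRing.Linear.copy (actV f) (laut (autV f)).
Definition actW (f : Autotop) : W -> W := laut (autW f).
HB.instance Definition _ f := GRing.Linear.copy (actW f) (laut (autW f)).
End Bimap.

Section Action.
Variables (k : comPzRingType) (U V W : lmodType k) (b : bimap U V W).
Implicit Types f g : Autotop b.

Lemma sgvalM (G : groupType) (S : groupClosed G) (x y : subgrp S) :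
  sgval (x * y)%g = (sgval x * sgval y)%g.
Proof. by []. Qed.
Lemma sgvalV (G : groupType) (S : groupClosed G) (x : subgrp S) :
  sgval x^-1%g = (sgval x)^-1%g.
Proof. by []. Qed.
Lemma autU_M f g : autU (f * g)%g = (autU f * autU g)%g.
Proof. by rewrite /autU sgvalM !gfstM. Qed.
Lemma autV_M f g : autV (f * g)%g = (autV f * autV g)%g.
Proof. by rewrite /autV sgvalM gfstM gsndM. Qed.
Lemma autW_M f g : autW (f * g)%g = (autW f * autW g)%g.
Proof. by rewrite /autW sgvalM gsndM. Qed.
Lemma autU_V f : autU f^-1%g = (autU f)^-1%g.
Proof. by rewrite /autU sgvalV !gfstV. Qed.
Lemma autV_V f : autV f^-1%g = (autV f)^-1%g.
Proof. by rewrite /autV sgvalV gfstV gsndV. Qed.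
Lemma autW_V f : autW f^-1%g = (autW f)^-1%g.
Proof. by rewrite /autW sgvalV gsndV. Qed.
Lemma actU_M f g u : actU (f * g)%g u = actU g (actU f u).
Proof. by rewrite /actU autU_M lautM. Qed.
Lemma actU1 u : actU (1%g : Autotop b) u = u. Proof. by []. Qed.
Lemma actUK f : cancel (actU f) (actU f^-1%g).
Proof. by rewrite /actU autU_V; apply: lautK. Qed.
Lemma actUVK f : cancel (actU f^-1%g) (actU f).
Proof. by rewrite /actU autU_V; apply: lautVK. Qed.
Lemma actV_M f g v : actV (f * g)%g v = actV g (actV f v).
Proof. by rewrite /actV autV_M lautM. Qed.
Lemma actV1 v : actV (1%g : Autotop b) v = v. Proof. by []. Qed.
Lemma actVK f : cancel (actV f) (actV f^-1%g).
Proof. by rewrite /actV autV_V; apply: lautK. Qed.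
Lemma actVVK f : cancel (actV f^-1%g) (actV f).
Proof. by rewrite /actV autV_V; apply: lautVK. Qed.
Lemma actW_M f g w : actW (f * g)%g w = actW g (actW f w).
Proof. by rewrite /actW autW_M lautM. Qed.
Lemma actW1 w : actW (1%g : Autotop b) w = w. Proof. by []. Qed.
Lemma actWK f : cancel (actW f) (actW f^-1%g).
Proof. by rewrite /actW autW_V; apply: lautK. Qed.
Lemma actWVK f : cancel (actW f^-1%g) (actW f).
Proof. by rewrite /actW autW_V; apply: lautVK. Qed.
Lemma actU_invM f g u :
  actU (f * g)^-1%g u = actU f^-1%g (actU g^-1%g u).
Proof. by rewrite invgM actU_M. Qed.
Lemma actU_inv1 u : actU (1^-1%g : Autotop b) u = u.
Proof. by rewrite invg1. Qed.
Lemma actV_invM f g v :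
  actV (f * g)^-1%g v = actV f^-1%g (actV g^-1%g v).
Proof. by rewrite invgM actV_M. Qed.
Lemma actV_inv1 v : actV (1^-1%g : Autotop b) v = v.
Proof. by rewrite invg1. Qed.
Lemma actW_invM f g w :
  actW (f * g)^-1%g w = actW f^-1%g (actW g^-1%g w).
Proof. by rewrite invgM actW_M. Qed.
Lemma actW_inv1 w : actW (1^-1%g : Autotop b) w = w.
Proof. by rewrite invg1. Qed.
Lemma actP f u v : b (actU f u) (actV f v) = actW f (b u v).
Proof. by have /asboolP := valP f; apply. Qed.

Lemma LU1 u : LU (1 : Lring b) u = u. Proof. by []. Qed.
Lemma LW1 w : LW (1 : Lring b) w = w. Proof. by []. Qed.
Lemma MU1 u : MU (1 : Mring b) u = u. Proof. by []. Qed.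
Lemma MV1 v : MV (1 : Mring b) v = v. Proof. by []. Qed.
Lemma RV1 v : RV (1 : Rring b) v = v. Proof. by []. Qed.
Lemma RW1 w : RW (1 : Rring b) w = w. Proof. by []. Qed.

Lemma Lext (x y : Lring b) : LU x =1 LU y -> LW x =1 LW y -> x = y.
Proof.
move=> xy1 xy2; apply: val_inj.
rewrite [LHS]surjective_pairing [RHS]surjective_pairing.
by congr pair; apply: linear_ext; [exact: xy1 | exact: xy2].
Qed.
Lemma Mext (x y : Mring b) : MU x =1 MU y -> MV x =1 MV y -> x = y.
Proof.
move=> xy1 xy2; apply: val_inj.
rewrite [LHS]surjective_pairing [RHS]surjective_pairing.
by congr pair; apply: linear_ext; [exact: xy1 | exact: xy2].
Qed.
Lemma Rext (x y : Rring b) : RV x =1 RV y -> RW x =1 RW y -> x = y.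
Proof.
move=> xy1 xy2; apply: val_inj.
rewrite [LHS]surjective_pairing [RHS]surjective_pairing.
by congr pair; apply: linear_ext; [exact: xy1 | exact: xy2].
Qed.
Lemma Cext (x y : centroid b) :
  CU x =1 CU y -> CV x =1 CV y -> CW x =1 CW y -> x = y.
Proof.
move=> xyU xyV xyW; apply: val_inj.
rewrite [LHS]surjective_pairing [RHS]surjective_pairing.
congr pair; last by apply: additive_ext; apply: xyW.
rewrite [LHS]surjective_pairing [RHS]surjective_pairing.
by congr pair; apply: additive_ext; [exact: xyU | exact: xyV].
Qed.

Definition commutesC : {pred Autotop b} := fun f =>
  `[< forall c : centroid b,
      [/\ forall u, actU f (CU c u) = CU c (actU f u),
          forall v, actV f (CV c v) = CV c (actV f v)
        & forall w, actW f (CW c w) = CW c (actW f w)] >].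

Fact commutesC_M : mulg_closed commutesC.
Proof.
move=> f g /asboolP fC /asboolP gC; apply/asboolP => c.
have [fU fV fW] := fC c; have [gU gV gW] := gC c.
by split=> ?; rewrite !(actU_M, actV_M, actW_M) ?fU ?gU ?fV ?gV ?fW ?gW.
Qed.
Fact commutesC1 : 1%g \in commutesC.
Proof. exact/asboolP. Qed.
Fact commutesC_V : invg_closed commutesC.
Proof.
move=> f /asboolP fC; apply/asboolP => c; have [fU fV fW] := fC c.
split=> ?.
- by rewrite -[RHS](actUK f) fU actUVK.
- by rewrite -[RHS](actVK f) fV actVVK.
- by rewrite -[RHS](actWK f) fW actWVK.
Qed.
HB.instance Definition _ := isMulClosed.Build (Autotop b) commutesC commutesC_M.
HB.instance Definition _ := isMul1Closed.Build (Autotop b) commutesC commutesC1.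
HB.instance Definition _ := isInvClosed.Build (Autotop b) commutesC commutesC_V.

Definition AutC := subgrp commutesC.
HB.instance Definition _ := Group.on AutC.

Definition commutesLMR : {pred Autotop b} := fun f =>
  `[< [/\ forall (x : Lring b) u, actU f (LU x u) = LU x (actU f u),
          forall (x : Lring b) w, actW f (LW x w) = LW x (actW f w)
        & forall (x : Mring b) u, actU f (MU x u) = MU x (actU f u)] /\
      [/\ forall (x : Mring b) v, actV f (MV x v) = MV x (actV f v),
          forall (x : Rring b) v, actV f (RV x v) = RV x (actV f v)
        & forall (x : Rring b) w, actW f (RW x w) = RW x (actW f w)] >].

Fact commutesLMR_M : mulg_closed commutesLMR.
Proof.
move=> f g /asboolP[[f1 f2 f3] [f4 f5 f6]] /asboolP[[g1 g2 g3] [g4 g5 g6]].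
apply/asboolP; split; split=> x ?; rewrite !(actU_M, actV_M, actW_M).
- by rewrite f1 g1.
- by rewrite f2 g2.
- by rewrite f3 g3.
- by rewrite f4 g4.
- by rewrite f5 g5.
- by rewrite f6 g6.
Qed.
Fact commutesLMR1 : 1%g \in commutesLMR.
Proof. exact/asboolP. Qed.
Fact commutesLMR_V : invg_closed commutesLMR.
Proof.
move=> f /asboolP[[f1 f2 f3] [f4 f5 f6]]; apply/asboolP.
split; split=> x ?.
- by rewrite -[RHS](actUK f) f1 actUVK.
- by rewrite -[RHS](actWK f) f2 actWVK.
- by rewrite -[RHS](actUK f) f3 actUVK.
- by rewrite -[RHS](actVK f) f4 actVVK.
- by rewrite -[RHS](actVK f) f5 actVVK.
- by rewrite -[RHS](actWK f) f6 actWVK.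
Qed.
HB.instance Definition _ := isMulClosed.Build (Autotop b) commutesLMR commutesLMR_M.
HB.instance Definition _ := isMul1Closed.Build (Autotop b) commutesLMR commutesLMR1.
HB.instance Definition _ := isInvClosed.Build (Autotop b) commutesLMR commutesLMR_V.

Definition AutLMR := subgrp commutesLMR.
HB.instance Definition _ := Group.on AutLMR.

Definition mk_linAut (X : lmodType k) (f g : {linear X -> X})
    (fg : cancel f g) (gf : cancel g f) : linAut X :=
  @mk_unit (mulMonoid (linEnd X)^c) f g
    (@linear_ext k X X (g \o f) idfun fg) (@linear_ext k X X (f \o g) idfun gf).

Lemma mk_linAutE (X : lmodType k) (f g : {linear X -> X})
    (fg : cancel f g) (gf : cancel g f) x : laut (mk_linAut fg gf) x = f x.
Proof. by []. Qed.

Definition mk_autotop (f : linAut U) (g : linAut V) (h : linAut W)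
    (fgh : forall u v, b (laut f u) (laut g v) = laut h (b u v)) : Autotop b :=
  @SubGrp (linAut U * linAut V * linAut W)%type (is_autotopism b) (f, g, h)
    (introT (asboolP _) fgh).

(* Conjugation x |-> f^-1 x f by an autotopism, composed from left to right. *)
Section Conjugation.
Variable f : Autotop b.

Fact conjL_subproof (x : Lring b) :
  ((actU f \o LU x \o actU f^-1%g : {linear U -> U}),
   (actW f \o LW x \o actW f^-1%g : {linear W -> W})) \in is_Lscalar b.
Proof. by apply/asboolP => u v /=; rewrite -actP -LUW -actP actVVK. Qed.
Definition conjL x : Lring b := SubRing (conjL_subproof x).

Fact conjM_subproof (x : Mring b) :
  ((actU f \o MU x \o actU f^-1%g : {linear U -> U}),
   (actV f \o MV x \o actV f^-1%g : {linear V -> V})) \in is_Mscalar b.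
Proof.
apply/asboolP => u v /=.
by rewrite -{1}(actVVK f v) actP MUV -actP actUVK.
Qed.
Definition conjM x : Mring b := SubRing (conjM_subproof x).

Fact conjR_subproof (x : Rring b) :
  ((actV f \o RV x \o actV f^-1%g : {linear V -> V}),
   (actW f \o RW x \o actW f^-1%g : {linear W -> W})) \in is_Rscalar b.
Proof. by apply/asboolP => u v /=; rewrite -actP -RVW -actP actUVK. Qed.
Definition conjR x : Rring b := SubRing (conjR_subproof x).

Fact conjC_subproof (x : centroid b) :
  ((actU f \o CU x \o actU f^-1%g : {additive U -> U}),
   (actV f \o CV x \o actV f^-1%g : {additive V -> V}),
   (actW f \o CW x \o actW f^-1%g : {additive W -> W})) \in is_Cscalar b.
Proof.
apply/asboolP => u v /=; split.
  by rewrite -actP -CUW -actP actVVK.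
by rewrite -actP -CVW -actP actUVK.
Qed.
Definition conjC x : centroid b := SubRing (conjC_subproof x).

Definition conjLMR (x : LMR b) : LMR b :=
  ((conjL x.1.1, conjM x.1.2), conjR x.2).

Lemma LU_conj x u : LU (conjL x) u = actU f (LU x (actU f^-1%g u)).
Proof. by []. Qed.
Lemma LW_conj x w : LW (conjL x) w = actW f (LW x (actW f^-1%g w)).
Proof. by []. Qed.
Lemma MU_conj x u : MU (conjM x) u = actU f (MU x (actU f^-1%g u)).
Proof. by []. Qed.
Lemma MV_conj x v : MV (conjM x) v = actV f (MV x (actV f^-1%g v)).
Proof. by []. Qed.
Lemma RV_conj x v : RV (conjR x) v = actV f (RV x (actV f^-1%g v)).
Proof. by []. Qed.
Lemma RW_conj x w : RW (conjR x) w = actW f (RW x (actW f^-1%g w)).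
Proof. by []. Qed.
Lemma CU_conj x u : CU (conjC x) u = actU f (CU x (actU f^-1%g u)).
Proof. by []. Qed.
Lemma CV_conj x v : CV (conjC x) v = actV f (CV x (actV f^-1%g v)).
Proof. by []. Qed.
Lemma CW_conj x w : CW (conjC x) w = actW f (CW x (actW f^-1%g w)).
Proof. by []. Qed.
End Conjugation.

End Action.
Arguments commutesC {k U V W} b _.
Arguments commutesLMR {k U V W} b _.

Section ConjugationMorphisms.
Variables (k : comPzRingType) (U V W : lmodType k) (b : bimap U V W).
Implicit Types f g : Autotop b.

Lemma LU_B (x y : Lring b) u : LU (x - y) u = LU x u - LU y u.
Proof. by []. Qed.
Lemma LW_B (x y : Lring b) w : LW (x - y) w = LW x w - LW y w.
Proof. by []. Qed.
Lemma MU_B (x y : Mring b) u : MU (x - y) u = MU x u - MU y u.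
Proof. by []. Qed.
Lemma MV_B (x y : Mring b) v : MV (x - y) v = MV x v - MV y v.
Proof. by []. Qed.
Lemma RV_B (x y : Rring b) v : RV (x - y) v = RV x v - RV y v.
Proof. by []. Qed.
Lemma RW_B (x y : Rring b) w : RW (x - y) w = RW x w - RW y w.
Proof. by []. Qed.
Lemma CU_B (x y : centroid b) u : CU (x - y) u = CU x u - CU y u.
Proof. by rewrite /CU srvalB !fstB addEndcB. Qed.
Lemma CV_B (x y : centroid b) v : CV (x - y) v = CV x v - CV y v.
Proof. by rewrite /CV srvalB fstB sndB addEndcB. Qed.
Lemma CW_B (x y : centroid b) w : CW (x - y) w = CW x w - CW y w.
Proof. by rewrite /CW srvalB sndB addEndcB. Qed.
Lemma CU_M (x y : centroid b) u : CU (x * y) u = CU y (CU x u).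
Proof. by rewrite /CU srvalM !fstM addEndcM. Qed.
Lemma CV_M (x y : centroid b) v : CV (x * y) v = CV y (CV x v).
Proof. by rewrite /CV srvalM fstM sndM addEndcM. Qed.
Lemma CW_M (x y : centroid b) w : CW (x * y) w = CW y (CW x w).
Proof. by rewrite /CW srvalM sndM addEndcM. Qed.
Lemma CU1 u : CU (1 : centroid b) u = u. Proof. by []. Qed.
Lemma CV1 v : CV (1 : centroid b) v = v. Proof. by []. Qed.
Lemma CW1 w : CW (1 : centroid b) w = w. Proof. by []. Qed.

Fact conjLMR_zmod f : zmod_morphism (conjLMR f).
Proof.
move=> [[x1 x2] x3] [[y1 y2] y3]; congr (_, _, _).
- by apply: Lext => ?; [rewrite LU_conj !LU_B raddfB
                       | rewrite LW_conj !LW_B raddfB].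
- by apply: Mext => ?; [rewrite MU_conj !MU_B raddfB
                       | rewrite MV_conj !MV_B raddfB].
- by apply: Rext => ?; [rewrite RV_conj !RV_B raddfB
                       | rewrite RW_conj !RW_B raddfB].
Qed.
Fact conjLMR_monoid f : monoid_morphism (conjLMR f).
Proof.
split=> [|[[x1 x2] x3] [[y1 y2] y3]]; congr (_, _, _).
- by apply: Lext => ?; rewrite !(LU_conj, LW_conj, LU1, LW1) !(actUVK, actWVK).
- by apply: Mext => ?; rewrite !(MU_conj, MV_conj, MU1, MV1) !(actUVK, actVVK).
- by apply: Rext => ?; rewrite !(RV_conj, RW_conj, RV1, RW1) !(actVVK, actWVK).
- by apply: Lext => ?; [rewrite LU_conj !LU_M !LU_conj actUK
                       | rewrite LW_conj !LW_M !LW_conj actWK].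
- by apply: Mext => ?; [rewrite MU_conj !MU_M !MU_conj actUK
                       | rewrite MV_conj !MV_M !MV_conj actVK].
- by apply: Rext => ?; [rewrite RV_conj !RV_M !RV_conj actVK
                       | rewrite RW_conj !RW_M !RW_conj actWK].
Qed.
HB.instance Definition _ f :=
  GRing.isZmodMorphism.Build (LMR b) (LMR b) (conjLMR f) (conjLMR_zmod f).
HB.instance Definition _ f :=
  GRing.isMonoidMorphism.Build (LMR b) (LMR b) (conjLMR f) (conjLMR_monoid f).

Fact conjC_zmod f : zmod_morphism (conjC f).
Proof.
move=> x y; apply: Cext => ?.
- by rewrite !(CU_conj, CU_B) raddfB.
- by rewrite !(CV_conj, CV_B) raddfB.
- by rewrite !(CW_conj, CW_B) raddfB.
Qed.
Fact conjC_monoid f : monoid_morphism (conjC f).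
Proof.
split=> [|x y]; apply: Cext => ?.
- by rewrite CU_conj !CU1 actUVK.
- by rewrite CV_conj !CV1 actVVK.
- by rewrite CW_conj !CW1 actWVK.
- by rewrite !(CU_conj, CU_M) actUK.
- by rewrite !(CV_conj, CV_M) actVK.
- by rewrite !(CW_conj, CW_M) actWK.
Qed.
HB.instance Definition _ f :=
  GRing.isZmodMorphism.Build (centroid b) (centroid b) (conjC f) (conjC_zmod f).
HB.instance Definition _ f :=
  GRing.isMonoidMorphism.Build (centroid b) (centroid b) (conjC f) (conjC_monoid f).

Lemma conjLMR_M f g x : conjLMR (f * g)%g x = conjLMR g (conjLMR f x).
Proof.
case: x => [[x1 x2] x3]; congr (_, _, _).
- apply: Lext => ?; first by rewrite !LU_conj actU_M actU_invM.
  by rewrite !LW_conj actW_M actW_invM.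
- apply: Mext => ?; first by rewrite !MU_conj actU_M actU_invM.
  by rewrite !MV_conj actV_M actV_invM.
- apply: Rext => ?; first by rewrite !RV_conj actV_M actV_invM.
  by rewrite !RW_conj actW_M actW_invM.
Qed.
Lemma conjLMR1 x : conjLMR (1%g : Autotop b) x = x.
Proof.
case: x => [[x1 x2] x3]; congr (_, _, _).
- apply: Lext => ?; first by rewrite LU_conj actU_inv1 actU1.
  by rewrite LW_conj actW_inv1 actW1.
- apply: Mext => ?; first by rewrite MU_conj actU_inv1 actU1.
  by rewrite MV_conj actV_inv1 actV1.
- apply: Rext => ?; first by rewrite RV_conj actV_inv1 actV1.
  by rewrite RW_conj actW_inv1 actW1.
Qed.
Lemma conjC_M f g x : conjC (f * g)%g x = conjC g (conjC f x).
Proof.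
apply: Cext => ?.
- by rewrite !CU_conj actU_M actU_invM.
- by rewrite !CV_conj actV_M actV_invM.
- by rewrite !CW_conj actW_M actW_invM.
Qed.
Lemma conjC1 x : conjC (1%g : Autotop b) x = x.
Proof.
apply: Cext => ?.
- by rewrite CU_conj actU_inv1 actU1.
- by rewrite CV_conj actV_inv1 actV1.
- by rewrite CW_conj actW_inv1 actW1.
Qed.

Definition mk_ringAut (A : pzRingType) (f g : {rmorphism A -> A})
    (fg : cancel f g) (gf : cancel g f) : ringAut A :=
  @mk_unit (ringEnd A) f g
    (@rmorphism_ext A A (g \o f) idfun fg) (@rmorphism_ext A A (f \o g) idfun gf).

Fact conjLMR_K f : cancel (conjLMR f) (conjLMR f^-1%g).
Proof. by move=> x; rewrite -conjLMR_M mulgV conjLMR1. Qed.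
Fact conjLMR_VK f : cancel (conjLMR f^-1%g) (conjLMR f).
Proof. by move=> x; rewrite -conjLMR_M mulVg conjLMR1. Qed.
Fact conjC_K f : cancel (conjC f) (conjC f^-1%g).
Proof. by move=> x; rewrite -conjC_M mulgV conjC1. Qed.
Fact conjC_VK f : cancel (conjC f^-1%g) (conjC f).
Proof. by move=> x; rewrite -conjC_M mulVg conjC1. Qed.

Definition conjLMR_aut f : ringAut (LMR b) :=
  mk_ringAut (conjLMR_K f) (conjLMR_VK f).
Definition conjC_aut f : ringAut (centroid b) :=
  mk_ringAut (conjC_K f) (conjC_VK f).

Definition autotop_to_OutC f : Out (centroid b) :=
  quot_pi (Inn (centroid b)) (conjC_aut f).
End ConjugationMorphisms.

Section Nondegenerate.
Variables (k : comPzRingType) (U V W : lmodType k) (b : bimap U V W).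
Hypothesis hb : fully_nondegenerate b.

Lemma nondegU u u' : (forall v, b u v = b u' v) -> u = u'.
Proof.
case: hb => hU _ _ uu'; apply/subr0_eq/hU => v.
by rewrite bmulBl uu' subrr.
Qed.
Lemma nondegV v v' : (forall u, b u v = b u v') -> v = v'.
Proof.
case: hb => _ hV _ vv'; apply/subr0_eq/hV => u.
by rewrite bmulBr vv' subrr.
Qed.
Lemma nondegW (f g : {additive W -> W}) :
  (forall u v, f (b u v) = g (b u v)) -> f =1 g.
Proof.
case: hb => _ _ hW fg w; have [s ->] := hW w.
by rewrite !raddf_sum; apply: eq_bigr.
Qed.

Lemma LU_MU (x : Lring b) (y : Mring b) u : LU x (MU y u) = MU y (LU x u).
Proof. by apply: nondegU => v; rewrite LUW !MUV LUW. Qed.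
Lemma MV_RV (x : Mring b) (y : Rring b) v : MV x (RV y v) = RV y (MV x v).
Proof. by apply: nondegV => u; rewrite -MUV !RVW MUV. Qed.
Lemma LW_RW (x : Lring b) (y : Rring b) w : LW x (RW y w) = RW y (LW x w).
Proof.
apply: (nondegW (f := LW x \o RW y) (g := RW y \o LW x)) => u v /=.
by rewrite -RVW -!LUW -RVW.
Qed.

Lemma CU_scalable (c : centroid b) : scalable (CU c).
Proof. by move=> s u; apply: nondegU => v; rewrite CUW bmulZl -bmulZr -CUW bmulZr bmulZl. Qed.
Lemma CV_scalable (c : centroid b) : scalable (CV c).
Proof. by move=> s v; apply: nondegV => u; rewrite CVW bmulZr -bmulZl -CVW bmulZl bmulZr. Qed.
Lemma CW_scalable (c : centroid b) : scalable (CW c).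
Proof.
move=> s; apply: (nondegW (f := CW c \o *:%R s) (g := *:%R s \o CW c)) => u v /=.
by rewrite -bmulZl -!CUW CU_scalable bmulZl.
Qed.

Fact mk_linear_subproof (X : lmodType k) (f : {additive X -> X}) :
  scalable f -> linear f.
Proof. by move=> fZ s x y; rewrite raddfD fZ. Qed.
Definition mk_linear (X : lmodType k) (f : {additive X -> X})
    (fZ : scalable f) : {linear X -> X} :=
  HB.pack (f : X -> X)
    (GRing.isLinear.Build k X X *:%R f (mk_linear_subproof fZ)).

Definition CUlin c : linEnd U := mk_linear (@CU_scalable c).
Definition CVlin c : linEnd V := mk_linear (@CV_scalable c).
Definition CWlin c : linEnd W := mk_linear (@CW_scalable c).

Fact C_to_L_subproof c : (CUlin c, CWlin c) \in is_Lscalar b.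
Proof. by apply/asboolP => u v; apply: CUW. Qed.
Fact C_to_M_subproof c : (CUlin c, CVlin c) \in is_Mscalar b.
Proof. by apply/asboolP => u v; rewrite /= CUW CVW. Qed.
Fact C_to_R_subproof c : (CVlin c, CWlin c) \in is_Rscalar b.
Proof. by apply/asboolP => u v; apply: CVW. Qed.

Definition centroid_to_LMR (c : centroid b) : LMR b :=
  (SubRing (C_to_L_subproof c), SubRing (C_to_M_subproof c),
   SubRing (C_to_R_subproof c)).

Lemma LU_C c u : LU (centroid_to_LMR c).1.1 u = CU c u. Proof. by []. Qed.
Lemma LW_C c w : LW (centroid_to_LMR c).1.1 w = CW c w. Proof. by []. Qed.
Lemma MU_C c u : MU (centroid_to_LMR c).1.2 u = CU c u. Proof. by []. Qed.
Lemma MV_C c v : MV (centroid_to_LMR c).1.2 v = CV c v. Proof. by []. Qed.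
Lemma RV_C c v : RV (centroid_to_LMR c).2 v = CV c v. Proof. by []. Qed.
Lemma RW_C c w : RW (centroid_to_LMR c).2 w = CW c w. Proof. by []. Qed.

Definition OutC_LMR := COut centroid_to_LMR.

Fact conjLMR_Clinear (f : AutC b) :
  conjLMR_aut (sgval f) \in Clinear centroid_to_LMR.
Proof.
apply/asboolP=> c [[x1 x2] x3]; have /asboolP/(_ c)[fU fV fW] := valP f.
congr (_, _, _); rewrite ?fstM ?sndM.
- apply: Lext => ?; first by rewrite LU_conj !LU_M !LU_C LU_conj fU.
  by rewrite LW_conj !LW_M !LW_C LW_conj fW.
- apply: Mext => ?; last by rewrite MV_conj !MV_M !MV_C MV_conj fV.
  rewrite MU_conj !MU_M !MU_C MU_conj.
  by rewrite -[CU c (actU _^-1%g _)](actUK (sgval f)) fU actUVK.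
- apply: Rext => ?.
    rewrite RV_conj !RV_M !RV_C RV_conj.
    by rewrite -[CV c (actV _^-1%g _)](actVK (sgval f)) fV actVVK.
  rewrite RW_conj !RW_M !RW_C RW_conj.
  by rewrite -[CW c (actW _^-1%g _)](actWK (sgval f)) fW actWVK.
Qed.
Definition autC_to_OutC_LMR (f : AutC b) : OutC_LMR :=
  quot_pi (CInn centroid_to_LMR)
    (@SubGrp _ (Clinear centroid_to_LMR) _ (conjLMR_Clinear f)).
End Nondegenerate.

Section ScalarAction.
Variables (k : comPzRingType) (U V W : lmodType k) (b : bimap U V W).
Hypothesis hb : fully_nondegenerate b.

Section Components.
Variable x : ringUnits (LMR b).
Let l := (rval x).1.1. Let l' := (rinv x).1.1.
Let m := (rval x).1.2. Let m' := (rinv x).1.2.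
Let r := (rval x).2. Let r' := (rinv x).2.

Lemma LVK : l * l' = 1. Proof. by rewrite /l /l' -!fstM rvalK. Qed.
Lemma LKV : l' * l = 1. Proof. by rewrite /l /l' -!fstM rinvK. Qed.
Lemma MVK : m * m' = 1. Proof. by rewrite /m /m' -sndM -fstM rvalK. Qed.
Lemma MKV : m' * m = 1. Proof. by rewrite /m /m' -sndM -fstM rinvK. Qed.
Lemma RVK : r * r' = 1. Proof. by rewrite /r /r' -sndM rvalK. Qed.
Lemma RKV : r' * r = 1. Proof. by rewrite /r /r' -sndM rinvK. Qed.

Fact scalU_K : cancel (LU l' \o MU m) (LU l \o MU m').
Proof. by move=> u /=; rewrite -LU_MU // -LU_M LVK LU1 -MU_M MVK MU1. Qed.
Fact scalU_VK : cancel (LU l \o MU m') (LU l' \o MU m).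
Proof. by move=> u /=; rewrite -LU_MU // -LU_M LKV LU1 -MU_M MKV MU1. Qed.
Fact scalV_K : cancel (MV m' \o RV r) (MV m \o RV r').
Proof. by move=> v /=; rewrite -MV_RV // -MV_M MVK MV1 -RV_M RVK RV1. Qed.
Fact scalV_VK : cancel (MV m \o RV r') (MV m' \o RV r).
Proof. by move=> v /=; rewrite -MV_RV // -MV_M MKV MV1 -RV_M RKV RV1. Qed.
Fact scalW_K : cancel (LW l' \o RW r) (LW l \o RW r').
Proof. by move=> w /=; rewrite -LW_RW // -LW_M LVK LW1 -RW_M RVK RW1. Qed.
Fact scalW_VK : cancel (LW l \o RW r') (LW l' \o RW r).
Proof. by move=> w /=; rewrite -LW_RW // -LW_M LKV LW1 -RW_M RKV RW1. Qed.

Fact scal_autotop u v :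
  b (laut (mk_linAut scalU_K scalU_VK) u) (laut (mk_linAut scalV_K scalV_VK) v) =
  laut (mk_linAut scalW_K scalW_VK) (b u v).
Proof.
by rewrite !mk_linAutE /= LUW MUV -MV_M MVK MV1 RVW.
Qed.

(* (lambda, mu, rho) acts by u |-> lambda^-1 u mu, v |-> mu^-1 v rho and
   w |-> lambda^-1 w rho. *)
Definition LMR_to_autotop : Autotop b := mk_autotop scal_autotop.

Lemma actU_scal u : actU LMR_to_autotop u = LU l' (MU m u). Proof. by []. Qed.
Lemma actV_scal v : actV LMR_to_autotop v = MV m' (RV r v). Proof. by []. Qed.
Lemma actW_scal w : actW LMR_to_autotop w = LW l' (RW r w). Proof. by []. Qed.
End Components.

Section Inclusions.
Variables (A B C : pzRingType).
Fact unit_in1_subproof (x : ringUnits A) : ((rval x, 1, 1) : A * B * C) * (rinv x, 1, 1) = 1.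
Proof. by congr (_, _, _); rewrite /= ?rvalK ?mulr1. Qed.
Fact unit_in1_subproof' (x : ringUnits A) : ((rinv x, 1, 1) : A * B * C) * (rval x, 1, 1) = 1.
Proof. by congr (_, _, _); rewrite /= ?rinvK ?mulr1. Qed.
Definition unit_in1 (x : ringUnits A) : ringUnits (A * B * C)%type :=
  @mk_unit (mulMonoid (A * B * C)%type) _ _
    (unit_in1_subproof x) (unit_in1_subproof' x).
Fact unit_in2_subproof (x : ringUnits B) : ((1, rval x, 1) : A * B * C) * (1, rinv x, 1) = 1.
Proof. by congr (_, _, _); rewrite /= ?rvalK ?mulr1. Qed.
Fact unit_in2_subproof' (x : ringUnits B) : ((1, rinv x, 1) : A * B * C) * (1, rval x, 1) = 1.
Proof. by congr (_, _, _); rewrite /= ?rinvK ?mulr1. Qed.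
Definition unit_in2 (x : ringUnits B) : ringUnits (A * B * C)%type :=
  @mk_unit (mulMonoid (A * B * C)%type) _ _
    (unit_in2_subproof x) (unit_in2_subproof' x).
Fact unit_in3_subproof (x : ringUnits C) : ((1, 1, rval x) : A * B * C) * (1, 1, rinv x) = 1.
Proof. by congr (_, _, _); rewrite /= ?rvalK ?mulr1. Qed.
Fact unit_in3_subproof' (x : ringUnits C) : ((1, 1, rinv x) : A * B * C) * (1, 1, rval x) = 1.
Proof. by congr (_, _, _); rewrite /= ?rinvK ?mulr1. Qed.
Definition unit_in3 (x : ringUnits C) : ringUnits (A * B * C)%type :=
  @mk_unit (mulMonoid (A * B * C)%type) _ _
    (unit_in3_subproof x) (unit_in3_subproof' x).
End Inclusions.

Definition L_to_autotop (x : ringUnits (Lring b)) : Autotop b :=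
  LMR_to_autotop (unit_in1 (Mring b) (Rring b) x).
Definition M_to_autotop (x : ringUnits (Mring b)) : Autotop b :=
  LMR_to_autotop (unit_in2 (Lring b) (Rring b) x).
Definition R_to_autotop (x : ringUnits (Rring b)) : Autotop b :=
  LMR_to_autotop (unit_in3 (Lring b) (Mring b) x).

Definition AutC_incl (f : AutC b) : Autotop b := sgval f.

Lemma LU_CU (x : Lring b) (c : centroid b) u : LU x (CU c u) = CU c (LU x u).
Proof. by rewrite -!(MU_C hb) LU_MU. Qed.
Lemma MU_CU (x : Mring b) (c : centroid b) u : MU x (CU c u) = CU c (MU x u).
Proof. by rewrite -!(LU_C hb) LU_MU. Qed.
Lemma MV_CV (x : Mring b) (c : centroid b) v : MV x (CV c v) = CV c (MV x v).
Proof. by rewrite -!(RV_C hb) MV_RV. Qed.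
Lemma RV_CV (x : Rring b) (c : centroid b) v : RV x (CV c v) = CV c (RV x v).
Proof. by rewrite -!(MV_C hb) MV_RV. Qed.
Lemma LW_CW (x : Lring b) (c : centroid b) w : LW x (CW c w) = CW c (LW x w).
Proof. by rewrite -!(RW_C hb) LW_RW. Qed.
Lemma RW_CW (x : Rring b) (c : centroid b) w : RW x (CW c w) = CW c (RW x w).
Proof. by rewrite -!(LW_C hb) LW_RW. Qed.

Lemma scal_commutesC x : LMR_to_autotop x \in commutesC b.
Proof.
apply/asboolP => c; split=> ?.
- by rewrite !actU_scal MU_CU LU_CU.
- by rewrite !actV_scal RV_CV MV_CV.
- by rewrite !actW_scal RW_CW LW_CW.
Qed.

Lemma commutesLMR_C (f : Autotop b) : f \in commutesLMR b -> f \in commutesC b.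
Proof.
move=> /asboolP[[f1 f2 _] [_ f5 _]]; apply/asboolP => c; split=> ?.
- by rewrite -!(LU_C hb) f1.
- by rewrite -!(RV_C hb) f5.
- by rewrite -!(LW_C hb) f2.
Qed.

Definition center_unit (z : ringUnits (center (LMR b))) : ringUnits (LMR b) :=
  @mk_unit (mulMonoid (LMR b)) (srval (rval z)) (srval (rinv z))
    (etrans (esym (srvalM _ _)) (congr1 (@srval _ _) (rvalK z)))
    (etrans (esym (srvalM _ _)) (congr1 (@srval _ _) (rinvK z))).

Lemma central_comm (z : center (LMR b)) x : srval z * x = x * srval z.
Proof. by have /asboolP := valP z; apply. Qed.
Lemma central_L (z : center (LMR b)) x : (srval z).1.1 * x = x * (srval z).1.1.
Proof. by have /(congr1 (fun t => t.1.1)) := central_comm z (x, 0, 0). Qed.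
Lemma central_M (z : center (LMR b)) x : (srval z).1.2 * x = x * (srval z).1.2.
Proof. by have /(congr1 (fun t => t.1.2)) := central_comm z (0, x, 0). Qed.
Lemma central_R (z : center (LMR b)) x : (srval z).2 * x = x * (srval z).2.
Proof. by have /(congr1 snd) := central_comm z (0, 0, x). Qed.

Lemma center_commutesLMR z : LMR_to_autotop (center_unit z) \in commutesLMR b.
Proof.
have rvalE : rval (center_unit z) = srval (rval z) by [].
have rinvE : rinv (center_unit z) = srval (rinv z) by [].
apply/asboolP; split; split=> x ?.
- by rewrite !actU_scal rvalE rinvE -LU_MU // -!LU_M central_L.
- by rewrite !actW_scal rvalE rinvE -LW_RW // -!LW_M central_L.
- by rewrite !actU_scal rvalE rinvE -!MU_M -central_M MU_M LU_MU // MU_M.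
- by rewrite !actV_scal rvalE rinvE -MV_RV // -!MV_M central_M.
- by rewrite !actV_scal rvalE rinvE -!RV_M -central_R RV_M MV_RV // RV_M.
- by rewrite !actW_scal rvalE rinvE -!RW_M -central_R RW_M LW_RW // RW_M.
Qed.

Definition center_to_LMR_AutLMR (z : ringUnits (center (LMR b))) :
    (ringUnits (LMR b) * opGroup (AutLMR b))%type :=
  (center_unit z,
   SubGrp (center_commutesLMR z : LMR_to_autotop (center_unit z) \in commutesLMR b)).

Fact LMR_AutLMR_to_AutC_subproof
    (p : (ringUnits (LMR b) * opGroup (AutLMR b))%type) :
  (LMR_to_autotop p.1 * (sgval (p.2 : AutLMR b))^-1)%g \in commutesC b.
Proof.
apply: gpredM; first exact: scal_commutesC.
by apply: gpredVr; apply: commutesLMR_C; apply: (valP (p.2 : AutLMR b)).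
Qed.
(* Since alpha |-> alpha^-1 reverses products, this map is a morphism of groups
   only for the opposite multiplication on the factor AutLMR b, which need not
   be abelian. *)
Definition LMR_AutLMR_to_AutC
    (p : (ringUnits (LMR b) * opGroup (AutLMR b))%type) : AutC b :=
  SubGrp (LMR_AutLMR_to_AutC_subproof p).
End ScalarAction.

Section Corner.
Variables (k : comPzRingType) (U V W : lmodType k) (b : bimap U V W).

Section CornerBimap.
Variable e : LMR b.
Let e1 : Lring b := e.1.1.
Let e2 : Mring b := e.1.2.
Let e3 : Rring b := e.2.

Definition in_cornerU : {pred U} := fun u =>
  `[< exists u', u = LU e1 (MU e2 u') >].
Definition in_cornerV : {pred V} := fun v =>
  `[< exists v', v = MV e2 (RV e3 v') >].
Definition in_cornerW : {pred W} := fun w =>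
  `[< exists w', w = LW e1 (RW e3 w') >].

Fact cornerU_closed : submod_closed in_cornerU.
Proof.
split; first by apply/asboolP; exists 0; rewrite !raddf0.
move=> s _ _ /asboolP[u ->] /asboolP[u' ->]; apply/asboolP.
by exists (s *: u + u'); rewrite !linearP.
Qed.
Fact cornerV_closed : submod_closed in_cornerV.
Proof.
split; first by apply/asboolP; exists 0; rewrite !raddf0.
move=> s _ _ /asboolP[u ->] /asboolP[u' ->]; apply/asboolP.
by exists (s *: u + u'); rewrite !linearP.
Qed.
Fact cornerW_closed : submod_closed in_cornerW.
Proof.
split; first by apply/asboolP; exists 0; rewrite !raddf0.
move=> s _ _ /asboolP[u ->] /asboolP[u' ->]; apply/asboolP.
by exists (s *: u + u'); rewrite !linearP.
Qed.
HB.instance Definition _ := GRing.isSubmodClosed.Build k U in_cornerU cornerU_closed.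
HB.instance Definition _ := GRing.isSubmodClosed.Build k V in_cornerV cornerV_closed.
HB.instance Definition _ := GRing.isSubmodClosed.Build k W in_cornerW cornerW_closed.

Definition cornerU := submod in_cornerU.
Definition cornerV := submod in_cornerV.
Definition cornerW := submod in_cornerW.
HB.instance Definition _ := GRing.Lmodule.on cornerU.
HB.instance Definition _ := GRing.Lmodule.on cornerV.
HB.instance Definition _ := GRing.Lmodule.on cornerW.

Fact corner_bmul_subproof (u : cornerU) (v : cornerV) :
  b (smval u) (smval v) \in in_cornerW.
Proof.
have /asboolP[u' ->] := valP u; have /asboolP[v' ->] := valP v.
apply/asboolP; exists (b (MU e2 (MU e2 u')) v').
by rewrite LUW -MUV RVW.
Qed.
Definition corner_bmul (u : cornerU) (v : cornerV) : cornerW :=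
  SubMod (corner_bmul_subproof u v).
Fact corner_bmulDl u u' v :
  corner_bmul (u + u') v = corner_bmul u v + corner_bmul u' v.
Proof. by apply: val_inj; apply: bmulDl. Qed.
Fact corner_bmulDr u v v' :
  corner_bmul u (v + v') = corner_bmul u v + corner_bmul u v'.
Proof. by apply: val_inj; apply: bmulDr. Qed.
Fact corner_bmulZl s u v : corner_bmul (s *: u) v = s *: corner_bmul u v.
Proof. by apply: val_inj; apply: bmulZl. Qed.
Fact corner_bmulZr s u v : corner_bmul u (s *: v) = s *: corner_bmul u v.
Proof. by apply: val_inj; apply: bmulZr. Qed.
Definition corner_bimap : bimap cornerU cornerV cornerW :=
  Bimap corner_bmulDl corner_bmulDr corner_bmulZl corner_bmulZr.
End CornerBimap.

Hypothesis hb : fully_nondegenerate b.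

Section CornerAction.
Variable e : LMR b.
Let e1 : Lring b := e.1.1.
Let e2 : Mring b := e.1.2.
Let e3 : Rring b := e.2.

(* The elements of the corner ring e1 L e1 are the e1 * x * e1 with x in L, and
   similarly for M and R; cornerLU x is the action of e1 * x * e1 on eUe. *)
Fact cornerLU_subproof (x : Lring b) (u : cornerU e) :
  LU (e1 * x * e1) (smval u) \in in_cornerU e.
Proof.
have /asboolP[u' ->] := valP u; apply/asboolP; exists (LU (x * e1 * e1) u').
by rewrite !LU_M !(LU_MU hb).
Qed.
Definition cornerLU x u : cornerU e := SubMod (cornerLU_subproof x u).

Fact cornerLW_subproof (x : Lring b) (w : cornerW e) :
  LW (e1 * x * e1) (smval w) \in in_cornerW e.
Proof.
have /asboolP[w' ->] := valP w; apply/asboolP; exists (LW (x * e1 * e1) w').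
by rewrite !LW_M !(LW_RW hb).
Qed.
Definition cornerLW x w : cornerW e := SubMod (cornerLW_subproof x w).

Fact cornerMU_subproof (x : Mring b) (u : cornerU e) :
  MU (e2 * x * e2) (smval u) \in in_cornerU e.
Proof.
have /asboolP[u' ->] := valP u; apply/asboolP; exists (MU (e2 * (e2 * x)) u').
by rewrite !MU_M !(LU_MU hb).
Qed.
Definition cornerMU x u : cornerU e := SubMod (cornerMU_subproof x u).

Fact cornerMV_subproof (x : Mring b) (v : cornerV e) :
  MV (e2 * x * e2) (smval v) \in in_cornerV e.
Proof.
have /asboolP[v' ->] := valP v; apply/asboolP; exists (MV (x * e2 * e2) v').
by rewrite !MV_M !(MV_RV hb).
Qed.
Definition cornerMV x v : cornerV e := SubMod (cornerMV_subproof x v).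

Fact cornerRV_subproof (x : Rring b) (v : cornerV e) :
  RV (e3 * x * e3) (smval v) \in in_cornerV e.
Proof.
have /asboolP[v' ->] := valP v; apply/asboolP; exists (RV (e3 * (e3 * x)) v').
by rewrite !RV_M !(MV_RV hb).
Qed.
Definition cornerRV x v : cornerV e := SubMod (cornerRV_subproof x v).

Fact cornerRW_subproof (x : Rring b) (w : cornerW e) :
  RW (e3 * x * e3) (smval w) \in in_cornerW e.
Proof.
have /asboolP[w' ->] := valP w; apply/asboolP; exists (RW (e3 * (e3 * x)) w').
by rewrite !RW_M !(LW_RW hb).
Qed.
Definition cornerRW x w : cornerW e := SubMod (cornerRW_subproof x w).

Definition commutes_corner : {pred Autotop (corner_bimap e)} := fun f =>
  `[< [/\ forall x u, actU f (cornerLU x u) = cornerLU x (actU f u),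
          forall x w, actW f (cornerLW x w) = cornerLW x (actW f w)
        & forall x u, actU f (cornerMU x u) = cornerMU x (actU f u)] /\
      [/\ forall x v, actV f (cornerMV x v) = cornerMV x (actV f v),
          forall x v, actV f (cornerRV x v) = cornerRV x (actV f v)
        & forall x w, actW f (cornerRW x w) = cornerRW x (actW f w)] >].

Fact commutes_corner_M : mulg_closed commutes_corner.
Proof.
move=> f g /asboolP[[f1 f2 f3] [f4 f5 f6]] /asboolP[[g1 g2 g3] [g4 g5 g6]].
apply/asboolP; split; split=> x t.
- by rewrite !actU_M f1 g1.
- by rewrite !actW_M f2 g2.
- by rewrite !actU_M f3 g3.
- by rewrite !actV_M f4 g4.
- by rewrite !actV_M f5 g5.
- by rewrite !actW_M f6 g6.
Qed.
Fact commutes_corner1 : 1%g \in commutes_corner.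
Proof. exact/asboolP. Qed.
Fact commutes_corner_V : invg_closed commutes_corner.
Proof.
move=> f /asboolP[[f1 f2 f3] [f4 f5 f6]]; apply/asboolP.
split; split=> x t.
- by rewrite -[RHS](actUK f) f1 actUVK.
- by rewrite -[RHS](actWK f) f2 actWVK.
- by rewrite -[RHS](actUK f) f3 actUVK.
- by rewrite -[RHS](actVK f) f4 actVVK.
- by rewrite -[RHS](actVK f) f5 actVVK.
- by rewrite -[RHS](actWK f) f6 actWVK.
Qed.
HB.instance Definition _ := isMulClosed.Build (Autotop (corner_bimap e))
  commutes_corner commutes_corner_M.
HB.instance Definition _ := isMul1Closed.Build (Autotop (corner_bimap e))
  commutes_corner commutes_corner1.
HB.instance Definition _ := isInvClosed.Build (Autotop (corner_bimap e))
  commutes_corner commutes_corner_V.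

Definition AutCorner := subgrp commutes_corner.
HB.instance Definition _ := Group.on AutCorner.
End CornerAction.
End Corner.

Definition group_hom (G H : groupType) (f : G -> H) : Prop :=
  {morph f : x y / (x * y)%g >-> (x * y)%g}.

Definition exact_at (G H K : groupType) (f : G -> H) (g : H -> K) : Prop :=
  forall y : H, (exists x, f x = y) <-> g y = 1%g.

(* Exactness of 1 -> G -> H -> K, including that the maps are morphisms. *)
Definition exact_3 (G H K : groupType) (f : G -> H) (g : H -> K) : Prop :=
  [/\ group_hom f, group_hom g, injective f & exact_at f g].

(* Exactness of 1 -> G -> H -> K -> Q, including that the maps are morphisms. *)
Definition exact_4 (G H K Q : groupType)
    (f : G -> H) (g : H -> K) (h : K -> Q) : Prop :=
  [/\ [/\ group_hom f, group_hom g & group_hom h],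
      injective f, exact_at f g & exact_at g h].

Definition group_iso (G H : groupType) : Prop :=
  exists2 f : G -> H, group_hom f & bijective f.

(* Main.v *)
Require Import Defs.
From HB Require Import structures.
From mathcomp Require Import all_boot all_order all_algebra.
From mathcomp Require Import boolp.

Set Implicit Arguments.
Unset Strict Implicit.
Unset Printing Implicit Defensive.

Import GRing.Theory.
Local Open Scope ring_scope.

(** The scalars of a bimap are read off from autotopisms, and autotopisms act on
    the scalars by conjugation.

    If an autotopism [f] is trivial on [V], then [u f * v = (u * v) f], so the
    components of [f] on [U] and [W] form a unit of the ring of left scalars.
    The same reading of the autotopism equation, when [f] is trivial on [W] or
    on [U], gives a unit of the ring of mid or of right scalars.

    The centroid is commutative, so it has no nontrivial inner automorphisms,
    and conjugation by [f] is trivial in its outer automorphism group exactly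
    when [f] commutes with the centroid.

    The autotopism of a unit [x] of [LMR] conjugates the scalars by [x] itself
    ([conjLMR_scal]), and conjugation by [f] is trivial exactly when [f] commutes
    with all scalars ([conjLMR_id]).  So if conjugation by [f] is inner, [f]
    differs from the autotopism of a unit by an element of [AutLMR].  A unit
    whose autotopism lies in [AutLMR] is central by the same two facts.

    The corner isomorphism is a Morita argument.  Each of [U], [V], [W] is a
    bimodule over two of the rings, with full idempotents [e] and [f].  Writing
    [1 = sum_p x_p e y_p] and [1 = sum_q z_q f t_q], an endomorphism [h] of the
    corner that commutes with the corner rings extends to
      [x |-> sum_p sum_q x_p h (e y_p x z_q f) t_q].
    This extension is the only map [g] with [e a (g x) b f = h (e a x b f)] for
    all scalars [a], [b] ([cut_ext]), and an element of the bimodule is known once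
    all its cuts [e a x b f] are known ([corner_separates]).  Hence linearity
    over the scalars, invertibility and compatibility with the bimap are all
    checked on cuts.  Compatibility with the bimap also needs fullness in the mid
    scalars: a corner element [e (u * v) e] is a sum of products of elements of
    the corners of [U] and [V] ([cut_bmul]). *)

(** * Units, automorphisms and quotients *)

Lemma unit_ext_inv (M : monoidType) (x y : units M) : uinv x = uinv y -> x = y.
Proof. by move=> xy; apply: invg_inj; apply: unit_ext. Qed.

Lemma linAut_ext (k : comPzRingType) (X : lmodType k) (f g : linAut X) :
  laut f =1 laut g -> f = g.
Proof. by move=> fg; apply: unit_ext; apply: linear_ext. Qed.

Lemma ringAut_ext (A : pzRingType) (f g : ringAut A) : raut f =1 raut g -> f = g.
Proof. by move=> fg; apply: unit_ext; apply: rmorphism_ext. Qed.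

Lemma quot_pi_eq1 (G : groupType) (N : normalSubgroup G) (x : G) :
  quot_pi N x = 1%g <-> x \in N.
Proof.
rewrite -[x in x \in N]mulg1 -[1%g in X in _ <-> X]invg1.
exact: quot_piP.
Qed.

Lemma quot_pi_morph (G : groupType) (N : normalSubgroup G) :
  {morph quot_pi N : x y / (x * y)%g >-> (x * y)%g}.
Proof. by move=> x y; apply/esym/quot_piM. Qed.

Lemma rvalM (A : pzRingType) (x y : ringUnits A) : rval (x * y)%g = rval x * rval y.
Proof. by []. Qed.
Lemma rinvM (A : pzRingType) (x y : ringUnits A) : rinv (x * y)%g = rinv y * rinv x.
Proof. by []. Qed.

Lemma unit_in1M (A B C : pzRingType) :
  {morph @unit_in1 A B C : x y / (x * y)%g >-> (x * y)%g}.
Proof.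
move=> x y; apply: unit_ext.
change ((rval x * rval y, 1, 1) = (rval x * rval y, 1 * 1, 1 * 1) :> A * B * C).
by rewrite !mulr1.
Qed.
Lemma unit_in2M (A B C : pzRingType) :
  {morph @unit_in2 A B C : x y / (x * y)%g >-> (x * y)%g}.
Proof.
move=> x y; apply: unit_ext.
change ((1, rval x * rval y, 1) = (1 * 1, rval x * rval y, 1 * 1) :> A * B * C).
by rewrite !mulr1.
Qed.
Lemma unit_in3M (A B C : pzRingType) :
  {morph @unit_in3 A B C : x y / (x * y)%g >-> (x * y)%g}.
Proof.
move=> x y; apply: unit_ext.
change ((1, 1, rval x * rval y) = (1 * 1, 1 * 1, rval x * rval y) :> A * B * C).
by rewrite !mulr1.
Qed.

(** * Autotopisms trivial on one of the modules *)

Section Autotopisms.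
Variables (k : comPzRingType) (U V W : lmodType k) (b : bimap U V W).
Hypothesis hb : fully_nondegenerate b.
Implicit Types f g : Autotop b.

Lemma autotop_ext f g :
  actU f =1 actU g -> actV f =1 actV g -> actW f =1 actW g -> f = g.
Proof.
move=> fgU fgV fgW; apply: val_inj.
rewrite [LHS]surjective_pairing [RHS]surjective_pairing.
congr pair; last exact: linAut_ext.
rewrite [LHS]surjective_pairing [RHS]surjective_pairing.
by congr pair; apply: linAut_ext.
Qed.

Lemma autU_eq1 f : autU f = 1%g -> actU f =1 id.
Proof. by move=> f1 u; rewrite /actU f1. Qed.
Lemma autV_eq1 f : autV f = 1%g -> actV f =1 id.
Proof. by move=> f1 v; rewrite /actV f1. Qed.
Lemma autW_eq1 f : autW f = 1%g -> actW f =1 id.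
Proof. by move=> f1 w; rewrite /actW f1. Qed.

Lemma LMR_to_autotopM : {morph LMR_to_autotop hb : x y / (x * y)%g >-> (x * y)%g}.
Proof.
move=> x y; apply: autotop_ext => t.
- by rewrite actU_M !actU_scal rvalM rinvM !(fstM, sndM) LU_M MU_M !(LU_MU hb).
- by rewrite actV_M !actV_scal rvalM rinvM !(fstM, sndM) MV_M RV_M !(MV_RV hb).
- by rewrite actW_M !actW_scal rvalM rinvM !(fstM, sndM) LW_M RW_M !(LW_RW hb).
Qed.

(** Nondegeneracy lets a mid scalar be compared on [U] alone.  A unit [mu] acts on
    [U] by [mu] but on [V] by its inverse, so the autotopism of [mu] gives direct
    access to only one component of [mu]. *)
Lemma MextU (x y : Mring b) : MU x =1 MU y -> x = y.
Proof.
move=> xy; apply: Mext => // v; apply: (nondegV hb) => u.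
by rewrite -!MUV xy.
Qed.

Fact kerV_L_subproof f (fV : autV f = 1%g) :
  ((actU f : {linear U -> U}), (actW f : {linear W -> W})) \in is_Lscalar b.
Proof. by apply/asboolP => u v /=; rewrite -actP (autV_eq1 fV). Qed.
Definition kerV_L f fV : Lring b := SubRing (@kerV_L_subproof f fV).

(** Replacing [v] by [v f^-1] in [u f * v f = u * v] gives the balanced equation
    of a mid scalar. *)
Fact kerW_M_subproof f (fW : autW f = 1%g) :
  ((actU f : {linear U -> U}), (actV f^-1%g : {linear V -> V})) \in is_Mscalar b.
Proof. by apply/asboolP => u v /=; rewrite -{1}(actVVK f v) actP (autW_eq1 fW). Qed.
Definition kerW_M f fW : Mring b := SubRing (@kerW_M_subproof f fW).

Fact kerU_R_subproof f (fU : autU f = 1%g) :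
  ((actV f : {linear V -> V}), (actW f : {linear W -> W})) \in is_Rscalar b.
Proof. by apply/asboolP => u v /=; rewrite -actP (autU_eq1 fU). Qed.
Definition kerU_R f fU : Rring b := SubRing (@kerU_R_subproof f fU).

Lemma L_exact : exact_3 (L_to_autotop hb) (@autV k U V W b).
Proof.
split.
- by move=> x y; rewrite /L_to_autotop unit_in1M LMR_to_autotopM.
- exact: autV_M.
- move=> x y xy; apply: unit_ext_inv; apply: Lext => t.
    exact: (congr1 (fun f => actU f t) xy).
  exact: (congr1 (fun f => actW f t) xy).
- move=> f; split=> [[x <-]|fV]; first by apply: linAut_ext.
  have fV' : autV f^-1%g = 1%g by rewrite autV_V fV invg1.
  have KV : kerV_L fV' * kerV_L fV = 1.
    by apply: Lext => t; [apply: actUK | apply: actWK].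
  have VK : kerV_L fV * kerV_L fV' = 1.
    by apply: Lext => t; [apply: actUVK | apply: actWVK].
  (* The autotopism of a left unit acts by its inverse, so the preimage of f is
     the unit given by the inverse of f. *)
  exists (@mk_unit (mulMonoid (Lring b)) _ _ KV VK).
  by apply: autotop_ext => t //; rewrite (autV_eq1 fV).
Qed.

Lemma M_exact : exact_3 (M_to_autotop hb) (@autW k U V W b).
Proof.
split.
- by move=> x y; rewrite /M_to_autotop unit_in2M LMR_to_autotopM.
- exact: autW_M.
- move=> x y xy; apply: unit_ext; apply: MextU => t.
  exact: (congr1 (fun f => actU f t) xy).
- move=> f; split=> [[x <-]|fW]; first by apply: linAut_ext.
  have fW' : autW f^-1%g = 1%g by rewrite autW_V fW invg1.
  have KV : kerW_M fW * kerW_M fW' = 1.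
    by apply: Mext => t; [rewrite MU_M; apply: actUK | rewrite MV_M; apply: actVK].
  have VK : kerW_M fW' * kerW_M fW = 1.
    by apply: Mext => t; [rewrite MU_M; apply: actUVK | rewrite MV_M; apply: actVVK].
  exists (@mk_unit (mulMonoid (Mring b)) _ _ KV VK).
  by apply: autotop_ext => t //; rewrite (autW_eq1 fW).
Qed.

Lemma R_exact : exact_3 (R_to_autotop hb) (@autU k U V W b).
Proof.
split.
- by move=> x y; rewrite /R_to_autotop unit_in3M LMR_to_autotopM.
- exact: autU_M.
- move=> x y xy; apply: unit_ext; apply: Rext => t.
    exact: (congr1 (fun f => actV f t) xy).
  exact: (congr1 (fun f => actW f t) xy).
- move=> f; split=> [[x <-]|fU]; first by apply: linAut_ext.
  have fU' : autU f^-1%g = 1%g by rewrite autU_V fU invg1.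
  have KV : kerU_R fU * kerU_R fU' = 1.
    by apply: Rext => t; [rewrite RV_M; apply: actVK | rewrite RW_M; apply: actWK].
  have VK : kerU_R fU' * kerU_R fU = 1.
    by apply: Rext => t; [rewrite RV_M; apply: actVVK | rewrite RW_M; apply: actWVK].
  exists (@mk_unit (mulMonoid (Rring b)) _ _ KV VK).
  by apply: autotop_ext => t //; rewrite (autU_eq1 fU).
Qed.

(** * The centroid *)

Lemma CW_ext (x y : centroid b) :
  (forall u v, CW x (b u v) = CW y (b u v)) -> CW x =1 CW y.
Proof. exact: (nondegW hb). Qed.

(** Letting [c] act through [V] and [d] through [U] makes the order in which they
    are applied irrelevant. *)
Lemma centroid_mulC (c d : centroid b) : c * d = d * c.
Proof.
have cdW u v : CW (c * d) (b u v) = CW (d * c) (b u v).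
  by rewrite !CW_M -CVW -!CUW CVW -CUW.
apply: Cext => [u|v|w].
- by apply: (nondegU hb) => v; rewrite !CUW.
- by apply: (nondegV hb) => u; rewrite !CVW.
- exact: CW_ext.
Qed.

Lemma inner_centroid (f : ringAut (centroid b)) :
  f \in inner (A := centroid b) <-> raut f =1 id.
Proof.
split=> [/asboolP[x fx] a|f1]; last first.
  by apply/asboolP; exists 1%g => a; rewrite f1 [RHS]mulr1 mul1r.
by rewrite fx -mulrA [a * _]centroid_mulC mulrA rinvK mul1r.
Qed.

Lemma conjC_id f : conjC f =1 id <-> f \in commutesC b.
Proof.
split=> [f1|/asboolP fC c].
  apply/asboolP=> c; split=> t.
  - by rewrite -[in RHS](f1 c) CU_conj actUK.
  - by rewrite -[in RHS](f1 c) CV_conj actVK.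
  - by rewrite -[in RHS](f1 c) CW_conj actWK.
have [fU fV fW] := fC c; apply: Cext => t.
- by rewrite CU_conj fU actUVK.
- by rewrite CV_conj fV actVVK.
- by rewrite CW_conj fW actWVK.
Qed.

Lemma C_exact : exact_3 (@AutC_incl k U V W b) (@autotop_to_OutC k U V W b).
Proof.
split=> //.
- move=> f g; rewrite /autotop_to_OutC -quot_pi_morph; congr quot_pi.
  apply: ringAut_ext => c; exact: conjC_M.
- exact: val_inj.
- move=> f; rewrite /autotop_to_OutC quot_pi_eq1 inner_centroid.
  rewrite -[X in _ <-> X]/(conjC f =1 id) conjC_id.
  by split=> [[g <-]|fC]; [apply: valP | exists (SubGrp fC)].
Qed.

(** * Conjugation on the scalar rings *)

Lemma LMR_to_autotopV x :
  LMR_to_autotop hb x^-1%g = (LMR_to_autotop hb x)^-1%g.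
Proof.
apply: (mulgI (LMR_to_autotop hb x)); rewrite -LMR_to_autotopM !mulgV.
by apply: autotop_ext.
Qed.

(** On each module only one of the two scalars of [x] lies on the same side as
    [a]; the other commutes with [a] and cancels against its inverse. *)
Lemma conjLMR_scal (x : ringUnits (LMR b)) a :
  conjLMR (LMR_to_autotop hb x) a = rinv x * a * rval x.
Proof.
case: a => [[a1 a2] a3]; congr (_, _, _); rewrite ?fstM ?sndM.
- apply: Lext => t.
    rewrite LU_conj -LMR_to_autotopV !actU_scal !LU_M !(LU_MU hb).
    by rewrite -MU_M MKV.
  rewrite LW_conj -LMR_to_autotopV !actW_scal !LW_M !(LW_RW hb).
  by rewrite -RW_M RKV.
- apply: Mext => t.
    rewrite MU_conj -LMR_to_autotopV !actU_scal !MU_M -!(LU_MU hb).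
    by rewrite -LU_M LKV.
  rewrite MV_conj -LMR_to_autotopV !actV_scal !MV_M !(MV_RV hb).
  by rewrite -RV_M RKV.
- apply: Rext => t.
    rewrite RV_conj -LMR_to_autotopV !actV_scal !RV_M -!(MV_RV hb).
    by rewrite -MV_M MKV.
  rewrite RW_conj -LMR_to_autotopV !actW_scal !RW_M -!(LW_RW hb).
  by rewrite -LW_M LKV.
Qed.

Lemma conjLMR_id f : conjLMR f =1 id <-> f \in commutesLMR b.
Proof.
split=> [f1|/asboolP[[f1 f2 f3] [f4 f5 f6]] [[x1 x2] x3]].
  have fL x : conjL f x = x by have /(congr1 (fun t => t.1.1)) := f1 (x, 0, 0).
  have fM x : conjM f x = x by have /(congr1 (fun t => t.1.2)) := f1 (0, x, 0).
  have fR x : conjR f x = x by have /(congr1 snd) := f1 (0, 0, x).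
  apply/asboolP; split; split=> x t.
  - by rewrite -[in RHS](fL x) LU_conj actUK.
  - by rewrite -[in RHS](fL x) LW_conj actWK.
  - by rewrite -[in RHS](fM x) MU_conj actUK.
  - by rewrite -[in RHS](fM x) MV_conj actVK.
  - by rewrite -[in RHS](fR x) RV_conj actVK.
  - by rewrite -[in RHS](fR x) RW_conj actWK.
congr (_, _, _).
- by apply: Lext => t; [rewrite LU_conj f1 actUVK | rewrite LW_conj f2 actWVK].
- by apply: Mext => t; [rewrite MU_conj f3 actUVK | rewrite MV_conj f4 actVVK].
- by apply: Rext => t; [rewrite RV_conj f5 actVVK | rewrite RW_conj f6 actWVK].
Qed.

Lemma scal_commutesLMR (x : ringUnits (LMR b)) :
  LMR_to_autotop hb x \in commutesLMR b -> forall a, rval x * a = a * rval x.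
Proof.
move=> /conjLMR_id xC a; rewrite -{1}[a]xC conjLMR_scal.
by rewrite !mulrA rvalK mul1r.
Qed.

Lemma center_unit_onto (x : ringUnits (LMR b)) :
  (forall a, rval x * a = a * rval x) -> exists z, center_unit z = x.
Proof.
move=> xC; have x'C a : rinv x * a = a * rinv x.
  by rewrite -[a in LHS]mulr1 -(rvalK x) (mulrA a) -xC !mulrA rinvK mul1r.
have xZ : rval x \in central (A := LMR b) by apply/asboolP.
have x'Z : rinv x \in central (A := LMR b) by apply/asboolP.
have KV : SubRing xZ * SubRing x'Z = 1 by apply: val_inj; apply: rvalK.
have VK : SubRing x'Z * SubRing xZ = 1 by apply: val_inj; apply: rinvK.
by exists (@mk_unit (mulMonoid (center (LMR b))) _ _ KV VK); apply: unit_ext.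
Qed.

(** This makes the two factors commute in [Autotop b], so that multiplying their
    images is a morphism. *)
Lemma LMR_AutLMR_commute x (f : AutLMR b) :
  (LMR_to_autotop hb x * sgval f = sgval f * LMR_to_autotop hb x)%g.
Proof.
have /asboolP[[f1 f2 f3] [f4 f5 f6]] := valP f.
apply: autotop_ext => t; rewrite !(actU_M, actV_M, actW_M).
- by rewrite !actU_scal f1 f3.
- by rewrite !actV_scal f4 f5.
- by rewrite !actW_scal f2 f6.
Qed.

Lemma center_unitM : {morph center_unit (b := b) : x y / (x * y)%g >-> (x * y)%g}.
Proof.
move=> x y; apply: unit_ext.
change (srval (rval (x * y)%g) = srval (rval x) * srval (rval y)).
by rewrite rvalM srvalM.
Qed.

Lemma LMR_exact : exact_4 (center_to_LMR_AutLMR hb) (LMR_AutLMR_to_AutC hb)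
  (autC_to_OutC_LMR hb).
Proof.
split; first split.
- move=> x y; congr (_, _); first exact: center_unitM.
  apply: val_inj; rewrite [LHS]/= center_unitM LMR_to_autotopM.
  have := LMR_AutLMR_commute (center_unit x) (SubGrp (center_commutesLMR hb y)).
  by move=> ->.
- move=> [x f] [y g]; apply: val_inj.
  (* The product of f and g in the opposite group is g * f. *)
  change (LMR_to_autotop hb (x * y)%g *
            (sgval (g : AutLMR b) * sgval (f : AutLMR b))^-1 =
          (LMR_to_autotop hb x * (sgval (f : AutLMR b))^-1) *
            (LMR_to_autotop hb y * (sgval (g : AutLMR b))^-1))%g.
  rewrite LMR_to_autotopM invgM -!mulgA; congr (_ * _)%g.
  rewrite !mulgA; congr (_ * _)%g.
  exact: (LMR_AutLMR_commute y (f : AutLMR b)^-1%g).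
- move=> f g; rewrite /autC_to_OutC_LMR -quot_pi_morph; congr quot_pi.
  by apply: val_inj; apply: ringAut_ext => c; apply: conjLMR_M.
- move=> x y /(congr1 fst) /(congr1 (@rval _)) xy.
  by apply: unit_ext; apply: val_inj.
- move=> [x f]; split=> [[z [<- <-]]|/(congr1 val) xf].
    by apply: val_inj; apply: mulgV.
  have {xf} xf : LMR_to_autotop hb x = sgval (f : AutLMR b).
    by apply/eqP; rewrite -divg_eq1; apply/eqP.
  have /scal_commutesLMR/center_unit_onto[z zx] :
      LMR_to_autotop hb x \in commutesLMR b.
    by rewrite xf; apply: (valP (f : AutLMR b)).
  exists z; congr (_, _) => //; apply: val_inj => /=.
  by rewrite zx.
- move=> f; rewrite /autC_to_OutC_LMR quot_pi_eq1.
  split=> [[[x g] <-]|/asboolP[x fx]].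
    apply/asboolP; exists x => a; rewrite -conjLMR_scal.
    change (conjLMR (LMR_to_autotop hb x * (sgval (g : AutLMR b))^-1)%g a =
            conjLMR (LMR_to_autotop hb x) a).
    rewrite conjLMR_M; have /conjLMR_id := valP (g : AutLMR b)^-1%g.
    exact.
  (* Conjugation by f and by the autotopism of x agree, so their quotient
     commutes with all scalars. *)
  have gC : ((sgval f)^-1 * LMR_to_autotop hb x)%g \in commutesLMR b.
    apply/conjLMR_id => a; rewrite conjLMR_M conjLMR_scal -fx.
    exact: conjLMR_VK.
  exists (x, SubGrp gC); apply: val_inj => /=.
  by rewrite invgM invgK mulVKg.
Qed.

End Autotopisms.

(** * Corners of bimodules at full idempotents *)

Lemma smval_inj (k : pzRingType) (X : lmodType k) (S : submodClosed X) :
  injective (@smval k X S).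
Proof. exact: val_inj. Qed.

Lemma smval_sum (k : pzRingType) (X : lmodType k) (S : submodClosed X) I (r : seq I)
  (F : I -> submod S) : smval (\sum_(i <- r) F i) = \sum_(i <- r) smval (F i).
Proof. exact: (big_morph (@smval k X S) (fun _ _ => erefl) erefl). Qed.

(** Structure common to [U], [V] and [W]: [ract] composes in the opposite order,
    because it is a right action written as a function. *)
Record bimodule (k : comPzRingType) (A B : pzRingType) (X : lmodType k) := Bimodule {
  lact : A -> {linear X -> X};
  ract : B -> {linear X -> X};
  lact1 : forall x, lact 1 x = x;
  ract1 : forall x, ract 1 x = x;
  lactB : forall a a' x, lact (a - a') x = lact a x - lact a' x;
  ractB : forall b b' x, ract (b - b') x = ract b x - ract b' x;
  lactM : forall a a' x, lact (a * a') x = lact a (lact a' x);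
  ractM : forall b b' x, ract (b * b') x = ract b' (ract b x);
  lractC : forall a b x, lact a (ract b x) = ract b (lact a x)
}.

(** The list [s] is a chosen decomposition witnessing that the two-sided ideal
    generated by [e] is the whole ring. *)
Definition full_idempotent (A : pzRingType) (e : A) (s : seq (A * A)) : Prop :=
  e * e = e /\ 1 = \sum_(p <- s) p.1 * e * p.2.

Section CornerModule.
Variables (k : comPzRingType) (A B : pzRingType) (X : lmodType k).
Variables (M : bimodule A B X) (e : A) (f : B) (S : submodClosed X).
Variables (s : seq (A * A)) (t : seq (B * B)).
Hypothesis SE : forall x, x \in S <-> exists y, x = lact M e (ract M f y).
Hypotheses (es : full_idempotent e s) (ft : full_idempotent f t).
Local Notation la := (lact M).
Local Notation ra := (ract M).

Lemma lact_sum I (r : seq I) (F : I -> A) x :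
  la (\sum_(i <- r) F i) x = \sum_(i <- r) la (F i) x.
Proof.
have la0 : la 0 x = 0 by rewrite -(subrr 0) lactB subrr.
have laN a : la (- a) x = - la a x by rewrite -sub0r lactB la0 sub0r.
apply: (big_morph (fun a => la a x)) => // a a'.
by rewrite -{1}(opprK a') lactB laN opprK.
Qed.

Lemma ract_sum I (r : seq I) (F : I -> B) x :
  ra (\sum_(i <- r) F i) x = \sum_(i <- r) ra (F i) x.
Proof.
have ra0 : ra 0 x = 0 by rewrite -(subrr 0) ractB subrr.
have raN a : ra (- a) x = - ra a x by rewrite -sub0r ractB ra0 sub0r.
apply: (big_morph (fun a => ra a x)) => // a a'.
by rewrite -{1}(opprK a') ractB raN opprK.
Qed.

Fact cut_subproof x : la e (ra f x) \in S.
Proof. by apply/SE; exists x. Qed.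
Definition cut x : submod S := SubMod (cut_subproof x).

Fact cut_linear : linear cut.
Proof. by move=> c x y; apply: smval_inj; rewrite /= !linearP. Qed.
HB.instance Definition _ := GRing.isLinear.Build k X (submod S) _ cut cut_linear.

Lemma lact_val (y : submod S) : la e (smval y) = smval y.
Proof. by have /SE[x /= ->] := valP y; rewrite -lactM es.1. Qed.
Lemma ract_val (y : submod S) : ra f (smval y) = smval y.
Proof. by have /SE[x /= ->] := valP y; rewrite -lractC -ractM ft.1. Qed.

Lemma cut_val (y : submod S) : cut (smval y) = y.
Proof. by apply: smval_inj; rewrite /= ract_val lact_val. Qed.

Lemma lact_expand x : \sum_(p <- s) la p.1 (la e (la p.2 x)) = x.
Proof.
rewrite -[RHS](lact1 M) es.2 lact_sum.
by apply: eq_bigr => p _; rewrite !lactM.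
Qed.
Lemma ract_expand x : \sum_(q <- t) ra q.2 (ra f (ra q.1 x)) = x.
Proof.
rewrite -[RHS](ract1 M) ft.2 ract_sum.
by apply: eq_bigr => p _; rewrite !ractM.
Qed.

(** Expanding [x] by fullness on both sides writes it in terms of its cuts, which
    is what reduces every identity in the bimodule to one in the corner. *)
Lemma corner_separates x y :
  (forall a b, cut (la a (ra b x)) = cut (la a (ra b y))) -> x = y.
Proof.
move=> xy; rewrite -(lact_expand x) -(lact_expand y); apply: eq_bigr => p _.
congr (la _ _).
rewrite -(ract_expand (la e (la p.2 x))) -(ract_expand (la e (la p.2 y))).
apply: eq_bigr => q _; congr (ra _ _).
by have /(congr1 (@smval _ _ _)) /= := xy p.2 q.1; rewrite !lractC.
Qed.

Definition bicommutes (g : X -> X) : Prop :=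
  (forall a x, g (la a x) = la a (g x)) /\ (forall b x, g (ra b x) = ra b (g x)).

(** On a corner element [y], [cut (la a y)] is the action of [e a e], so this is
    linearity over the corner rings. *)
Definition corner_bicommutes (h : submod S -> submod S) : Prop :=
  (forall a y, h (cut (la a (smval y))) = cut (la a (smval (h y)))) /\
  (forall b y, h (cut (ra b (smval y))) = cut (ra b (smval (h y)))).

Section Restriction.
Variable g : {linear X -> X}.
(** Cutting after [g] makes this defined and linear for every [g]; it is the
    restriction of [g] when [g] commutes with both actions ([val_res]). *)
Definition corner_res (y : submod S) : submod S := cut (g (smval y)).
Fact res_linear : linear corner_res.
Proof. by move=> c x y; rewrite /corner_res !linearP. Qed.
HB.instance Definition _ :=
  GRing.isLinear.Build k (submod S) (submod S) _ corner_res res_linear.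

Hypothesis gC : bicommutes g.
Lemma res_cut x : corner_res (cut x) = cut (g x).
Proof. by rewrite -[RHS]cut_val /corner_res /= gC.1 gC.2. Qed.
Lemma val_res y : smval (corner_res y) = g (smval y).
Proof.
rewrite /= -gC.2 -gC.1; congr (g _).
exact: (congr1 (@smval _ _ _) (cut_val y)).
Qed.
Lemma res_bicommutes : corner_bicommutes corner_res.
Proof. by split=> c y; rewrite res_cut val_res ?gC.1 ?gC.2. Qed.
End Restriction.

Section Extension.
Variable h : {linear submod S -> submod S}.
(** By Morita theory [X] is the tensor product of [A e], the corner and [f B] over
    the corner rings; this formula is the map that [h] induces on it. *)
Definition corner_ext (x : X) : X :=
  \sum_(p <- s) \sum_(q <- t)
    la p.1 (ra q.2 (smval (h (cut (la p.2 (ra q.1 x)))))).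
Fact ext_linear : linear corner_ext.
Proof.
move=> c x y; rewrite /corner_ext scaler_sumr -big_split; apply: eq_bigr => p _ /=.
by rewrite scaler_sumr -big_split; apply: eq_bigr => q _ /=; rewrite !linearP.
Qed.
HB.instance Definition _ := GRing.isLinear.Build k X X _ corner_ext ext_linear.

Hypothesis hC : corner_bicommutes h.

Lemma corner_bicommutes_lr a b (y : submod S) :
  h (cut (la a (ra b (smval y)))) = cut (la a (ra b (smval (h y)))).
Proof.
(* A two-sided action on the corner is a right action followed by a left one. *)
have cut_lr (z : submod S) : cut (la a (ra b (smval z))) =
    cut (la a (smval (cut (ra b (smval z))))).
  by apply: smval_inj; rewrite /= !lractC lact_val -(ractM _ f f) ft.1.
by rewrite !cut_lr hC.1 hC.2.
Qed.

(** The cut and the values of [h] supply idempotents on both sides of [a x_p] and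
    of [t_q b], so [h] commutes with them; fullness then collapses both sums. *)
Lemma cut_ext a b x :
  cut (la a (ra b (corner_ext x))) = h (cut (la a (ra b x))).
Proof.
rewrite -[x in RHS]lact_expand /corner_ext !linear_sum; apply: eq_bigr => p _ /=.
rewrite -[la p.2 x in RHS]ract_expand !linear_sum; apply: eq_bigr => q _ /=.
rewrite -!lractC -ractM -lactM -corner_bicommutes_lr /= ractM lactM.
by congr (h (cut _)); rewrite !lractC.
Qed.

Lemma ext_bicommutes : bicommutes corner_ext.
Proof.
split=> [a|b] x; apply: corner_separates => a' b'.
  by rewrite cut_ext -!lractC -!lactM cut_ext.
by rewrite cut_ext -!ractM cut_ext.
Qed.

Lemma res_ext (y : submod S) : corner_res corner_ext y = h y.
Proof. by have := cut_ext 1 1 (smval y); rewrite !lact1 !ract1 cut_val. Qed.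
End Extension.

Lemma ext_res (g : {linear X -> X}) : bicommutes g -> corner_ext (corner_res g) =1 g.
Proof.
move=> gC x; apply: corner_separates => a b.
by rewrite (cut_ext (res_bicommutes gC)) [LHS](res_cut gC) gC.1 gC.2.
Qed.

Lemma resK (g g' : {linear X -> X}) :
  bicommutes g' -> cancel g g' -> cancel (corner_res g) (corner_res g').
Proof. by move=> g'C gK y; rewrite [corner_res g y]/corner_res res_cut // gK cut_val. Qed.

Lemma extK (h h' : {linear submod S -> submod S}) :
  corner_bicommutes h -> corner_bicommutes h' -> cancel h h' ->
  cancel (corner_ext h) (corner_ext h').
Proof.
move=> hC h'C hK x; apply: corner_separates => a b.
by rewrite (cut_ext h'C) (cut_ext hC) hK.
Qed.
End CornerModule.

(** * Corners of bimaps *)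

Section Morita.
Variables (k : comPzRingType) (U V W : lmodType k) (b : bimap U V W).
Hypothesis hb : fully_nondegenerate b.

Definition Ubimod : bimodule (Lring b) (Mring b) U :=
  @Bimodule k (Lring b) (Mring b) U (fun x => LU x) (fun x => MU x)
    (@LU1 _ _ _ _ b) (@MU1 _ _ _ _ b) (@LU_B _ _ _ _ b) (@MU_B _ _ _ _ b)
    (@LU_M _ _ _ _ b) (@MU_M _ _ _ _ b) (LU_MU hb).
Definition Vbimod : bimodule (Mring b) (Rring b) V :=
  @Bimodule k (Mring b) (Rring b) V (fun x => MV x) (fun x => RV x)
    (@MV1 _ _ _ _ b) (@RV1 _ _ _ _ b) (@MV_B _ _ _ _ b) (@RV_B _ _ _ _ b)
    (@MV_M _ _ _ _ b) (@RV_M _ _ _ _ b) (MV_RV hb).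
Definition Wbimod : bimodule (Lring b) (Rring b) W :=
  @Bimodule k (Lring b) (Rring b) W (fun x => LW x) (fun x => RW x)
    (@LW1 _ _ _ _ b) (@RW1 _ _ _ _ b) (@LW_B _ _ _ _ b) (@RW_B _ _ _ _ b)
    (@LW_M _ _ _ _ b) (@RW_M _ _ _ _ b) (LW_RW hb).

Variable e : LMR b.
Variables (s1 : seq (Lring b * Lring b)) (s2 : seq (Mring b * Mring b))
  (s3 : seq (Rring b * Rring b)).
Hypotheses (h1 : full_idempotent e.1.1 s1) (h2 : full_idempotent e.1.2 s2)
  (h3 : full_idempotent e.2 s3).

Fact cornerU_spec u : u \in in_cornerU e <->
  exists u', u = lact Ubimod e.1.1 (ract Ubimod e.1.2 u').
Proof. by split=> /asboolP. Qed.
Fact cornerV_spec v : v \in in_cornerV e <->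
  exists v', v = lact Vbimod e.1.2 (ract Vbimod e.2 v').
Proof. by split=> /asboolP. Qed.
Fact cornerW_spec w : w \in in_cornerW e <->
  exists w', w = lact Wbimod e.1.1 (ract Wbimod e.2 w').
Proof. by split=> /asboolP. Qed.

Lemma commutesLMR_P (f : Autotop b) : f \in commutesLMR b <->
  [/\ bicommutes Ubimod (actU f), bicommutes Vbimod (actV f)
    & bicommutes Wbimod (actW f)].
Proof.
split=> [/asboolP[[? ? ?] [? ? ?]]|[[? ?] [? ?] [? ?]]]; first by split; split.
by apply/asboolP; split; split.
Qed.

Lemma commutes_corner_P (f : Autotop (corner_bimap e)) :
  f \in commutes_corner hb (e := e) <->
  [/\ corner_bicommutes cornerU_spec (actU f),
      corner_bicommutes cornerV_spec (actV f)
    & corner_bicommutes cornerW_spec (actW f)].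
Proof.
(* The idempotents around the scalar in the corner action are absorbed by the
   corner element on one side and by the cut on the other. *)
have cutLU x u : cut cornerU_spec (LU x (smval u)) = cornerLU hb x u.
  apply: smval_inj; rewrite /= !LU_M -(LU_MU hb).
  by rewrite (lact_val cornerU_spec h1 u : LU _ _ = _)
             (ract_val cornerU_spec h2 u : MU _ _ = _).
have cutMU x u : cut cornerU_spec (MU x (smval u)) = cornerMU hb x u.
  apply: smval_inj; rewrite /= !MU_M !(LU_MU hb).
  by rewrite (lact_val cornerU_spec h1 u : LU _ _ = _)
             (ract_val cornerU_spec h2 u : MU _ _ = _).
have cutMV x v : cut cornerV_spec (MV x (smval v)) = cornerMV hb x v.
  apply: smval_inj; rewrite /= !MV_M -(MV_RV hb).
  by rewrite (lact_val cornerV_spec h2 v : MV _ _ = _)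
             (ract_val cornerV_spec h3 v : RV _ _ = _).
have cutRV x v : cut cornerV_spec (RV x (smval v)) = cornerRV hb x v.
  apply: smval_inj; rewrite /= !RV_M !(MV_RV hb).
  by rewrite (lact_val cornerV_spec h2 v : MV _ _ = _)
             (ract_val cornerV_spec h3 v : RV _ _ = _).
have cutLW x w : cut cornerW_spec (LW x (smval w)) = cornerLW hb x w.
  apply: smval_inj; rewrite /= !LW_M -(LW_RW hb).
  by rewrite (lact_val cornerW_spec h1 w : LW _ _ = _)
             (ract_val cornerW_spec h3 w : RW _ _ = _).
have cutRW x w : cut cornerW_spec (RW x (smval w)) = cornerRW hb x w.
  apply: smval_inj; rewrite /= !RW_M !(LW_RW hb).
  by rewrite (lact_val cornerW_spec h1 w : LW _ _ = _)
             (ract_val cornerW_spec h3 w : RW _ _ = _).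
split=> [/asboolP[[f1 f2 f3] [f4 f5 f6]]|[[f1 f3] [f4 f5] [f2 f6]]].
  split; split=> x t.
  - by rewrite !cutLU f1.
  - by rewrite !cutMU f3.
  - by rewrite !cutMV f4.
  - by rewrite !cutRV f5.
  - by rewrite !cutLW f2.
  - by rewrite !cutRW f6.
apply/asboolP; split; split=> x t.
- by rewrite -!cutLU; apply: f1.
- by rewrite -!cutLW; apply: f2.
- by rewrite -!cutMU; apply: f3.
- by rewrite -!cutMV; apply: f4.
- by rewrite -!cutRV; apply: f5.
- by rewrite -!cutRW; apply: f6.
Qed.

Section Restrict.
Variables (f : Autotop b) (fLMR : f \in commutesLMR b).
Fact commutesLMR_inv : f^-1%g \in commutesLMR b.
Proof. exact: gpredVr. Qed.
Let fC := (commutesLMR_P f).1 fLMR.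
Let fVC := (commutesLMR_P f^-1%g).1 commutesLMR_inv.

Fact resU_K : cancel (corner_res cornerU_spec (actU f))
  (corner_res cornerU_spec (actU f^-1%g)).
Proof. case: fVC => fU _ _; apply: (resK cornerU_spec h1 h2 fU);
  exact: actUK. Qed.
Fact resU_VK : cancel (corner_res cornerU_spec (actU f^-1%g))
  (corner_res cornerU_spec (actU f)).
Proof. case: fC => fU _ _; apply: (resK cornerU_spec h1 h2 fU);
  exact: actUVK. Qed.
Fact resV_K : cancel (corner_res cornerV_spec (actV f))
  (corner_res cornerV_spec (actV f^-1%g)).
Proof. case: fVC => _ fV _; apply: (resK cornerV_spec h2 h3 fV);
  exact: actVK. Qed.
Fact resV_VK : cancel (corner_res cornerV_spec (actV f^-1%g))
  (corner_res cornerV_spec (actV f)).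
Proof. case: fC => _ fV _; apply: (resK cornerV_spec h2 h3 fV);
  exact: actVVK. Qed.
Fact resW_K : cancel (corner_res cornerW_spec (actW f))
  (corner_res cornerW_spec (actW f^-1%g)).
Proof. case: fVC => _ _ fW; apply: (resK cornerW_spec h1 h3 fW);
  exact: actWK. Qed.
Fact resW_VK : cancel (corner_res cornerW_spec (actW f^-1%g))
  (corner_res cornerW_spec (actW f)).
Proof. case: fC => _ _ fW; apply: (resK cornerW_spec h1 h3 fW);
  exact: actWVK. Qed.

Fact res_autotop_subproof (u : cornerU e) (v : cornerV e) :
  corner_bimap e (laut (mk_linAut resU_K resU_VK) u)
                 (laut (mk_linAut resV_K resV_VK) v)
  = laut (mk_linAut resW_K resW_VK) (corner_bimap e u v).
Proof.
case: fC => fU fV fW; apply: smval_inj; rewrite !mk_linAutE.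
have EU := val_res cornerU_spec h1 h2 fU u.
have EV := val_res cornerV_spec h2 h3 fV v.
have EW := val_res cornerW_spec h1 h3 fW (corner_bimap e u v).
transitivity (b (actU f (smval u)) (actV f (smval v))); first by rewrite -EU -EV.
exact: etrans (actP _ _ _) (esym EW).
Qed.
Definition res_autotop : Autotop (corner_bimap e) := mk_autotop res_autotop_subproof.

Lemma res_autotop_commutes : res_autotop \in commutes_corner hb (e := e).
Proof.
by case: fC => fU fV fW; apply/commutes_corner_P; split;
   [ apply: (res_bicommutes cornerU_spec h1 h2)
   | apply: (res_bicommutes cornerV_spec h2 h3)
   | apply: (res_bicommutes cornerW_spec h1 h3)].
Qed.
End Restrict.

(** Inserting [1 = sum_p x_p e y_p] in the mid scalars between [u] and [v], and
    splitting the middle [e] as [e e], leaves one idempotent for each factor. *)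
Lemma cut_bmul u v : cut cornerW_spec (b u v) =
  \sum_(p <- s2) corner_bimap e (cut cornerU_spec (MU p.1 u))
                                (cut cornerV_spec (MV p.2 v)).
Proof.
apply: smval_inj; rewrite smval_sum /=.
have bmul_sumr I (r : seq I) (F : I -> V) u' :
    b u' (\sum_(i <- r) F i) = \sum_(i <- r) b u' (F i).
  by apply: (big_morph (b u')); [apply: bmulDr | apply: bmul0r].
rewrite -RVW -LUW -[RV _ v](lact_expand Vbimod h2) bmul_sumr.
apply: eq_bigr => p _ /=.
rewrite -MUV -[in MV e.1.2 _]h2.1.
by rewrite !(LU_MU hb) [RHS]MUV MV_M !(MV_RV hb).
Qed.

Section Extend.
Variables (g : Autotop (corner_bimap e)) (gcorner : g \in commutes_corner hb (e := e)).
Fact commutes_corner_inv : g^-1%g \in commutes_corner hb (e := e).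
Proof. exact: gpredVr. Qed.
Let gC := (commutes_corner_P g).1 gcorner.
Let gVC := (commutes_corner_P g^-1%g).1 commutes_corner_inv.

Local Notation extU := (corner_ext s1 s2 cornerU_spec).
Local Notation extV := (corner_ext s2 s3 cornerV_spec).
Local Notation extW := (corner_ext s1 s3 cornerW_spec).

Fact extU_K : cancel (extU (actU g)) (extU (actU g^-1%g)).
Proof. case: gC gVC => gU _ _ [gU' _ _]; apply: (extK h1 h2 gU gU');
  exact: actUK. Qed.
Fact extU_VK : cancel (extU (actU g^-1%g)) (extU (actU g)).
Proof. case: gC gVC => gU _ _ [gU' _ _]; apply: (extK h1 h2 gU' gU);
  exact: actUVK. Qed.
Fact extV_K : cancel (extV (actV g)) (extV (actV g^-1%g)).
Proof. case: gC gVC => _ gV _ [_ gV' _]; apply: (extK h2 h3 gV gV');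
  exact: actVK. Qed.
Fact extV_VK : cancel (extV (actV g^-1%g)) (extV (actV g)).
Proof. case: gC gVC => _ gV _ [_ gV' _]; apply: (extK h2 h3 gV' gV);
  exact: actVVK. Qed.
Fact extW_K : cancel (extW (actW g)) (extW (actW g^-1%g)).
Proof. case: gC gVC => _ _ gW [_ _ gW']; apply: (extK h1 h3 gW gW');
  exact: actWK. Qed.
Fact extW_VK : cancel (extW (actW g^-1%g)) (extW (actW g)).
Proof. case: gC gVC => _ _ gW [_ _ gW']; apply: (extK h1 h3 gW' gW);
  exact: actWVK. Qed.

Lemma ext_bmul u v :
  b (extU (actU g) u) (extV (actV g) v) = extW (actW g) (b u v).
Proof.
case: gC => gU gV gW.
apply: (corner_separates (SE := cornerW_spec) h1 h3) => x y.
rewrite (cut_ext h1 h3 gW).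
(* Outer scalars act on [u * v] through [u] on the left and through [v] on the
   right, so that [cut_bmul] applies to both sides. *)
have E u' v' : lact Wbimod x (ract Wbimod y (b u' v')) = b (LU x u') (RV y v').
  by rewrite LUW RVW.
rewrite !E !cut_bmul [RHS]linear_sum; apply: eq_bigr => p _.
rewrite -[RHS]actP.
congr (corner_bimap e _ _).
  have := cut_ext h1 h2 gU x p.1 u.
  by rewrite !lractC.
exact: (cut_ext h2 h3 gV p.2 y v).
Qed.

Fact ext_autotop_subproof u v :
  b (laut (mk_linAut extU_K extU_VK) u) (laut (mk_linAut extV_K extV_VK) v)
  = laut (mk_linAut extW_K extW_VK) (b u v).
Proof. exact: ext_bmul. Qed.

Definition ext_autotop : Autotop b := mk_autotop ext_autotop_subproof.

Lemma ext_autotop_commutes : ext_autotop \in commutesLMR b.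
Proof.
case: gC => gU gV gW; apply/commutesLMR_P; split.
- exact: (ext_bicommutes h1 h2 gU).
- exact: (ext_bicommutes h2 h3 gV).
- exact: (ext_bicommutes h1 h3 gW).
Qed.
End Extend.

Lemma corner_iso : group_iso (AutLMR b) (AutCorner hb e).
Proof.
pose r (f : AutLMR b) : AutCorner hb e := SubGrp (res_autotop_commutes (valP f)).
pose x (g : AutCorner hb e) : AutLMR b := SubGrp (ext_autotop_commutes (valP g)).
exists r.
  move=> f f'; apply: val_inj.
  have [fU fV fW] := (commutesLMR_P _).1 (valP f).
  have [fU' fV' fW'] := (commutesLMR_P _).1 (valP f').
  apply: autotop_ext => z.
  - by rewrite actU_M [RHS](res_cut cornerU_spec h1 h2 fU') /= -actU_M.
  - by rewrite actV_M [RHS](res_cut cornerV_spec h2 h3 fV') /= -actV_M.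
  - by rewrite actW_M [RHS](res_cut cornerW_spec h1 h3 fW') /= -actW_M.
exists x => f; apply: val_inj.
  have [fU fV fW] := (commutesLMR_P _).1 (valP f).
  apply: autotop_ext => z.
  - exact: (ext_res cornerU_spec h1 h2 fU).
  - exact: (ext_res cornerV_spec h2 h3 fV).
  - exact: (ext_res cornerW_spec h1 h3 fW).
have [fU fV fW] := (commutes_corner_P _).1 (valP f).
apply: autotop_ext => z.
- exact: (res_ext h1 h2 fU).
- exact: (res_ext h2 h3 fV).
- exact: (res_ext h1 h3 fW).
Qed.
End Morita.

Theorem theorem1p2 (k : comPzRingType) (U V W : lmodType k) (b : bimap U V W)
    (hb : fully_nondegenerate b) :
  [/\ exact_3 (L_to_autotop hb) (@autV k U V W b),
      exact_3 (M_to_autotop hb) (@autW k U V W b)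
    & exact_3 (R_to_autotop hb) (@autU k U V W b)] /\
  [/\ exact_3 (@AutC_incl k U V W b) (@autotop_to_OutC k U V W b),
      exact_4 (center_to_LMR_AutLMR hb) (LMR_AutLMR_to_AutC hb)
        (autC_to_OutC_LMR hb)
    & forall e : LMR b, e * e = e ->
      (forall x : LMR b, exists s : seq (LMR b * LMR b),
         x = \sum_(p <- s) p.1 * e * p.2) ->
      group_iso (AutLMR b) (AutCorner hb e)].
Proof.
split; split.
- exact: L_exact.
- exact: M_exact.
- exact: R_exact.
- exact: C_exact.
- exact: LMR_exact.
move=> e ee e_full; have [s s1] := e_full 1.
apply: (@corner_iso _ _ _ _ _ hb e
  [seq (p.1.1.1, p.2.1.1) | p <- s] [seq (p.1.1.2, p.2.1.2) | p <- s]
  [seq (p.1.2, p.2.2) | p <- s]).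
- split; first exact: (congr1 (fun x : LMR b => x.1.1) ee).
  rewrite big_map (_ : 1 = (1 : LMR b).1.1) // s1.
  exact: (big_morph (fun x : LMR b => x.1.1) (fun _ _ => erefl) erefl).
- split; first exact: (congr1 (fun x : LMR b => x.1.2) ee).
  rewrite big_map (_ : 1 = (1 : LMR b).1.2) // s1.
  exact: (big_morph (fun x : LMR b => x.1.2) (fun _ _ => erefl) erefl).
- split; first exact: (congr1 (fun x : LMR b => x.2) ee).
  rewrite big_map (_ : 1 = (1 : LMR b).2) // s1.
  exact: (big_morph (fun x : LMR b => x.2) (fun _ _ => erefl) erefl).
Qed.
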